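(* Let $(A,\mathcal{Q})$ be a base stratified algebra, where $\mathcal Q$ is the $n$-decomposition $\Lambda=\bigsqcup_{i=0}^n\Lambda_i$, with associated chain of idempotent ideals $0=J_0\subset J_1\subset\cdots\subset J_{n+1}=A$, chosen idempotents $f_1,\dots,f_{n+1}$ and algebras $A^{(i)}=f_{i+1}(A/J_i)f_{i+1}$, each equipped with a standardly based structure with poset $L_i$ and cell modules $W^0_i(p)$, $p\in L_i$. Then $A$ is standardly based for the poset $L=\bigsqcup_{i=0}^nL_i$, and its cell modules satisfy $$W(i,p)\cong Af_{i+1}\otimes_{f_{i+1}Af_{i+1}}W^0_i(p),\qquad 0\le i\le n,\ p\in L_i,$$ where $W^0_i(p)$ is regarded as an $f_{i+1}Af_{i+1}$-module on which $f_{i+1}J_if_{i+1}$ acts trivially.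
   Context: All algebras are finite-dimensional, associative and unital over a field $\Bbbk$; modules are finitely generated left modules; $\Lambda$ indexes simple $A$-modules $L(\lambda)$, with primitive idempotents $e_\lambda$. Standardly based structure on an algebra $A$: a poset $(L,\le)$ and two-sided ideals $A^{\ge p}$ ($p\in L$) with $A^{\ge p}\supseteq A^{\ge q}$ whenever $p<q$; setting $A^{>p}$ to be the sum of the $A^{\ge q}$ for $q>p$, one can choose complements $A^{(p)}$ of $A^{>p}$ in $A^{\ge p}$ with $\bigoplus_{p\in L}A^{(p)}=A$, and $A^{\ge p}/A^{>p}\cong W(p)\otimes_\Bbbk W'(p)$ as $A$-bimodules for some left $A$-module $W(p)$ and right $A$-module $W'(p)$. The $W(p)$ are the cell modules. An $n$-decomposition of $\Lambda$ is an ordered disjoint union $\Lambda=\bigsqcup_{i=0}^n\Lambda_i$; the associated chain of idempotent ideals has $J_i$ ($1\le i\le n+1$) the two-sided ideal generated by the $e_\lambda$ with $\lambda\in\Lambda_0\cup\dots\cup\Lambda_{i-1}$ (so $\lambda\in\Lambda_i$ iff $i$ is minimal with $J_{i+1}L(\lambda)\ne0$), $J_0=0$. Choose idempotents $f_i$ with $J_i=Af_iA$, $f_if_j=f_i=f_jf_i$ for $i\le j$, $f_{n+1}=1$. An idempotent ideal $J=AeA$ is base stratifying if $J$ is projective both as a left and as a right $A$-module and $eAe$ admits a standardly based structure. $(A,\mathcal Q)$ is base stratified if each $J_i/J_{i-1}$ is a base stratifying ideal of $A/J_{i-1}$, $1\le i\le n+1$. The poset $L=\bigsqcup_iL_i=\{(i,p):p\in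 L_i\}$ is ordered by $(i,p)\le(j,q)$ iff $i>j$, or $i=j$ and $p\le q$.
   Formalization: The posets L_i are taken to be finite (tacit for finite-dimensional algebras); infinite posets could only add indices with zero layers, and with infinite ascending chains of such indices the literal claim can fail. *)

(* Defs.v *)
From HB Require Import structures.
From mathcomp Require Import all_boot all_order all_algebra.
From mathcomp Require Import falgebra.
Set Implicit Arguments.
Unset Strict Implicit.
Unset Printing Implicit Defensive.
Import GRing.Theory.
Local Open Scope ring_scope.

Definition corner (K : fieldType) (A : falgType K) (e : A) : {vspace A} :=
  (<[e]> * fullv * <[e]>)%VS.

Definition lcorner (K : fieldType) (A : falgType K) (f : A) : {vspace A} :=
  (fullv * <[f]>)%VS.

Definition gen_ideal (K : fieldType) (A : falgType K) (X : seq A) : {vspace A} :=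
  (fullv * <<X>> * fullv)%VS.

Definition ideal_of (K : fieldType) (A : falgType K) (e : A) (I : {vspace A}) :=
  [/\ (I <= corner e)%VS, (corner e * I <= I)%VS & (I * corner e <= I)%VS].

Definition idempotent (K : fieldType) (A : falgType K) (e : A) := e * e = e.

Definition primitive_idempotent (K : fieldType) (A : falgType K) (e : A) :=
  [/\ e * e = e, e != 0 &
      forall x y : A, e = x + y -> x * x = x -> y * y = y ->
        x * y = 0 -> y * x = 0 -> x = 0 \/ y = 0].

(* Modules over the algebra  B(e,I) := eAe / I                         *)
(* A module of dimension d over B(e,I) is given by a representation
   r : A -> 'M_d, of which only the values on eAe matter: r is K-linear
   and multiplicative on eAe, r e = 1 and r vanishes on I.
   A LEFT module acts on column vectors  (x . v := r x *m v),
   a RIGHT module acts on row vectors    (v . x := v *m r x);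
   both conventions require exactly the same axioms. *)

Record rep (K : fieldType) (A : falgType K) := Rep {
  rdim : nat;
  ract : A -> 'M[K]_rdim }.

Definition linear_on (K : fieldType) (A : falgType K) (V : zmodType)
    (sc : K -> V -> V) (U : {vspace A}) (h : A -> V) :=
  forall (a : K) (x y : A), x \in U -> y \in U ->
    h (a *: x + y) = sc a (h x) + h y.

Definition is_rep (K : fieldType) (A : falgType K) (e : A) (I : {vspace A})
    (M : rep A) :=
  [/\ linear_on (fun a (m : 'M[K]_(rdim M)) => a *: m) (corner e) (ract M),
      forall x y, x \in corner e -> y \in corner e ->
        ract M (x * y) = ract M x *m ract M y,
      ract M e = 1%:M &
      forall x, x \in I -> ract M x = 0].

Definition rep_iso (K : fieldType) (A : falgType K) (M N : rep A) :=
  exists (P : 'M[K]_(rdim N, rdim M)) (Q : 'M[K]_(rdim M, rdim N)),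
    [/\ P *m Q = 1%:M, Q *m P = 1%:M &
        forall x : A, P *m ract M x = ract N x *m P].

(* simple left A-module: nonzero, and the only A-invariant subspaces of the
   column space K^d are 0 and K^d (a subspace is given by the rows of U,
   transposed). *)
Definition simple_rep (K : fieldType) (A : falgType K) (M : rep A) :=
  (0 < rdim M)%N /\
  forall U : 'M[K]_(rdim M),
    (forall x : A, (U *m (ract M x)^T <= U)%MS) ->
    U = 0 \/ (1%:M <= U)%MS.

Definition lprojective (K : fieldType) (A : falgType K) (e : A)
    (I : {vspace A}) (P : rep A) :=
  forall (M : rep A) (g : 'M[K]_(rdim P, rdim M)),
    is_rep e I M ->
    (forall x, x \in corner e -> g *m ract M x = ract P x *m g) ->
    \rank g = rdim P ->
    exists h : 'M[K]_(rdim M, rdim P),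
      (forall x, x \in corner e -> h *m ract P x = ract M x *m h) /\
      g *m h = 1%:M.

Definition rprojective (K : fieldType) (A : falgType K) (e : A)
    (I : {vspace A}) (P : rep A) :=
  forall (M : rep A) (g : 'M[K]_(rdim M, rdim P)),
    is_rep e I M ->
    (forall x, x \in corner e -> ract M x *m g = g *m ract P x) ->
    \rank g = rdim P ->
    exists h : 'M[K]_(rdim P, rdim M),
      (forall x, x \in corner e -> ract P x *m h = h *m ract M x) /\
      h *m g = 1%:M.

(* The left B(e,I)-module U/U' (U' <= U subspaces of A, stable under left
   multiplication by eAe) is isomorphic to the module M. *)
Definition lsubquot_iso (K : fieldType) (A : falgType K) (e : A)
    (U U' : {vspace A}) (M : rep A) :=
  exists pi : A -> 'cV[K]_(rdim M),
    [/\ linear_on (fun a (v : 'cV[K]_(rdim M)) => a *: v) U pi,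
        (forall v, exists2 u, u \in U & pi u = v),
        forall u, u \in U -> (pi u = 0 <-> u \in U') &
        forall x u, x \in corner e -> u \in U -> pi (x * u) = ract M x *m pi u].

Definition rsubquot_iso (K : fieldType) (A : falgType K) (e : A)
    (U U' : {vspace A}) (M : rep A) :=
  exists pi : A -> 'rV[K]_(rdim M),
    [/\ linear_on (fun a (v : 'rV[K]_(rdim M)) => a *: v) U pi,
        (forall v, exists2 u, u \in U & pi u = v),
        forall u, u \in U -> (pi u = 0 <-> u \in U') &
        forall x u, x \in corner e -> u \in U -> pi (u * x) = pi u *m ract M x].

Definition lproj_subquot (K : fieldType) (A : falgType K) (e : A)
    (I U U' : {vspace A}) :=
  exists M : rep A, [/\ is_rep e I M, lsubquot_iso e U U' M & lprojective e I M].

Definition rproj_subquot (K : fieldType) (A : falgType K) (e : A)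
    (I U U' : {vspace A}) :=
  exists M : rep A, [/\ is_rep e I M, rsubquot_iso e U U' M & rprojective e I M].

Definition is_poset (T : finType) (le : rel T) :=
  [/\ reflexive le, antisymmetric le & transitive le].

Definition strict (T : finType) (le : rel T) : rel T :=
  fun p q => le p q && (p != q).

(* Data of a standardly based structure on B(e,I) = eAe/I with poset T:
   - sb_ideal p : the preimage in eAe of the ideal (eAe/I)^{>=p};
   - sb_W p  : the cell module W(p) (left module), sb_W' p : W'(p) (right);
   - sb_phi p : a map inducing the bimodule isomorphism
       (eAe/I)^{>=p} / (eAe/I)^{>p}  ~=  W(p) (x)_K W'(p),
     where W(p) (x)_K W'(p) is identified with the dim W(p) x dim W'(p)
     matrices (w (x) w' |-> w *m w', a.X.b = W a *m X *m W' b). *)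
Record sb_struct (K : fieldType) (A : falgType K) (T : finType) := SB {
  sb_ideal : T -> {vspace A};
  sb_W : T -> rep A;
  sb_W' : T -> rep A;
  sb_phi : forall p : T, A -> 'M[K]_(rdim (sb_W p), rdim (sb_W' p)) }.

(* the preimage in eAe of (eAe/I)^{>p} = sum of the ideals of index q > p *)
Definition sb_gt (K : fieldType) (A : falgType K) (T : finType) (le : rel T)
    (I : {vspace A}) (S : sb_struct A T) (p : T) : {vspace A} :=
  (I + \sum_(q | strict le p q) sb_ideal S q)%VS.

Definition is_sb (K : fieldType) (A : falgType K) (e : A) (I : {vspace A})
    (T : finType) (le : rel T) (S : sb_struct A T) :=
  [/\ is_poset le,
      (* ideals of eAe/I, i.e. ideals of eAe containing I *)
      forall p, ideal_of e (sb_ideal S p) /\ (I <= sb_ideal S p)%VS,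
      forall p q, strict le p q -> (sb_ideal S q <= sb_ideal S p)%VS,
      (* complements A^(p) of A^{>p} in A^{>=p} with (+)_p A^(p) = eAe/I
         (lifted to subspaces C p of eAe meeting I trivially) *)
      exists C : T -> {vspace A},
        [/\ forall p, (C p <= sb_ideal S p)%VS,
            forall p, (C p + sb_gt le I S p)%VS = sb_ideal S p,
            forall p, (C p :&: sb_gt le I S p)%VS = 0%VS,
            directv (I + \sum_(p : T) C p)%VS &
            (I + \sum_(p : T) C p)%VS = corner e] &
      forall p,
      [/\ is_rep e I (sb_W S p) /\ is_rep e I (sb_W' S p),
          linear_on (fun a (m : 'M[K]_(rdim (sb_W S p), rdim (sb_W' S p))) => a *: m)
                    (sb_ideal S p) (sb_phi S p),
          (forall m, exists2 x, x \in sb_ideal S p & sb_phi S p x = m),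
          forall x, x \in sb_ideal S p -> (sb_phi S p x = 0 <-> x \in sb_gt le I S p) &
          forall a b x, a \in corner e -> b \in corner e -> x \in sb_ideal S p ->
            sb_phi S p (a * x * b)
              = ract (sb_W S p) a *m sb_phi S p x *m ract (sb_W' S p) b]].

(* With d0 = dim W0, A f (x)_K K^{d0} is identified with the space of
   d0-tuples of elements of A f  (x (x) w |-> (w_j x)_j).  The tensor
   product over fAf is the quotient by the span of the relations
   (x b) (x) w - x (x) (b.w),  x in Af, b in fAf, w in W0.             *)

Definition tens_elt (K : fieldType) (A : falgType K) d0
    (x : A) (w : 'cV[K]_d0) : {ffun 'I_d0 -> A} :=
  [ffun j => w j 0 *: x].

Definition tens_rel (K : fieldType) (A : falgType K) (W0 : rep A)
    (z : A * A * 'cV[K]_(rdim W0)) : {ffun 'I_(rdim W0) -> A} :=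
  tens_elt (z.1.1 * z.1.2) z.2 - tens_elt z.1.1 (ract W0 z.1.2 *m z.2).
Arguments tens_rel {K A} W0 z.

Definition in_tens_rels (K : fieldType) (A : falgType K) (f : A) (W0 : rep A)
    (t : {ffun 'I_(rdim W0) -> A}) :=
  exists s : seq (A * A * 'cV[K]_(rdim W0)),
    (forall z, z \in s -> z.1.1 \in lcorner f /\ z.1.2 \in corner f) /\
    t = \sum_(z <- s) tens_rel W0 z.
Arguments in_tens_rels {K A} f W0 t.

Definition tensor_iso (K : fieldType) (A : falgType K) (f : A) (W0 M : rep A) :=
  exists Psi : {ffun 'I_(rdim W0) -> A} -> 'cV[K]_(rdim M),
    let D := fun t : {ffun 'I_(rdim W0) -> A} => forall j, t j \in lcorner f in
    [/\ forall (a : K) t t', D t -> D t' -> Psi (a *: t + t') = a *: Psi t + Psi t',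
        forall (x : A) t, D t -> Psi [ffun j => x * t j] = ract M x *m Psi t,
        (forall v, exists2 t, D t & Psi t = v) &
        forall t, D t -> (Psi t = 0 <-> in_tens_rels f W0 t)].

Definition union_le (n : nat) (Lp : 'I_n.+1 -> finType)
    (le : forall i, rel (Lp i)) : rel {i : 'I_n.+1 & Lp i} :=
  fun x y => (tag y < tag x)%N ||
             ((tag x == tag y) && le (tag x) (tagged x) (tagged_as x y)).

Definition Jideal (K : fieldType) (A : falgType K) (Lam : finType) (n : nat)
    (eid : Lam -> A) (lev : Lam -> 'I_n.+1) (i : nat) : {vspace A} :=
  gen_ideal [seq eid l | l <- enum Lam & (lev l < i)%N].

(* Main.v *)
Require Import Defs.
From HB Require Import structures.
From mathcomp Require Import all_boot all_order all_algebra.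
From mathcomp Require Import falgebra.
Set Implicit Arguments.
Unset Strict Implicit.
Unset Printing Implicit Defensive.
Import GRing.Theory.
Local Open Scope ring_scope.

(** Fix a layer [i] and write [f = f_(i+1)], [J = J_i], [B = A/J].  Right
    projectivity of [BfB = J_(i+1)/J] splits the surjection [B^m -> BfB] given by
    a spanning family [v_k] of [Bf], which yields right-linear coefficient maps
    [t_k : BfB -> fB] with [z = sum_k v_k t_k(z)]; left projectivity similarly
    yields [s_l : BfB -> Bf] with [z = sum_l s_l(z) u_l].  Then
    [z |-> t_k(s_l(z))] embeds [BfB] into matrices over [fBf] and intertwines
    [B X B] with [X] for every ideal [X] of [fBf]: this replaces the isomorphism
    [Bf (x) fB = BfB] and the exactness of [Bf (x) -] and [- (x) fB].  The cell
    module [Af (x) W0] is realized as the image of the idempotent block matrix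
    [W0(t_k(v_l))], the element [x (x) w] being sent to the tuple [W0(t_k(x)) w].
    The ideal of index [(i,p)] is [J_i + A I_p A].  Its layers have independent
    complements because [I_p] meets the sum of the [I_q] with [q] not below [p]
    inside [I_(>p)], and the coefficient maps transport this property to [A]. *)

(** * Splitting block idempotents *)

(** Precomposing with the projection onto [U] gives the extension. It turns actions and cell maps,
    which are linear only on a corner or an ideal, into genuine linear maps that commute with
    sums. *)
Lemma linear_on_ext (K : fieldType) (A : falgType K) (V : vectType K)
    (U : {vspace A}) (h : A -> V) :
  linear_on (fun a (v : V) => a *: v) U h ->
  exists H : 'Hom(A, V), {in U, h =1 H}.
Proof.
move=> hlin; pose g x := h (projv U x).
have glin : linear g by move=> a x y; rewrite /g linearP hlin ?memv_proj.
pose gL : {linear A -> V} := HB.pack g (GRing.isLinear.Build _ _ _ _ g glin).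
by exists (linfun gL) => x Ux; rewrite lfunE /= /g projv_id.
Qed.

(** Idempotency reads [Cb Rb Cb Rb = Cb Rb]; a left inverse of [Cb] and a right inverse of [Rb]
    cancel the outer factors. *)
Lemma full_free_factorization_idem (K : fieldType) n r (B : 'M[K]_n)
    (Cb : 'M[K]_(n, r)) (Rb : 'M[K]_(r, n)) :
  B *m B = B -> Cb *m Rb = B -> row_full Cb -> row_free Rb -> Rb *m Cb = 1%:M.
Proof.
move=> BB eB /row_fullP[C' C'K] /row_freeP[R' R'K].
have := congr1 (fun X => C' *m X *m R') BB.
by rewrite -eB !mulmxA C'K mul1mx -!mulmxA R'K !mulmx1.
Qed.

(** The blocks assemble to one idempotent matrix, whose rank factorization is cut back into blocks:
    [P] embeds its image and [Q] projects onto it, so [r] is the rank. *)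
Lemma split_block_idempotent (K : fieldType) m d (E : 'I_m -> 'I_m -> 'M[K]_d) :
  (forall k l, \sum_j E k j *m E j l = E k l) ->
  exists r (Q : 'I_m -> 'M[K]_(r, d)) (P : 'I_m -> 'M[K]_(d, r)),
    \sum_k Q k *m P k = 1%:M /\ forall k l, P k *m Q l = E k l.
Proof.
move=> Eidem; pose B := \mxblock_(i < m, j < m) E i j.
have BB : B *m B = B.
  by rewrite /B mul_mxblock; apply: eq_mxblock => i j; apply: Eidem.
have CR : row_base B *m col_base B = 1%:M.
  by apply: full_free_factorization_idem BB (mulmx_base B) _ _;
    rewrite ?row_base_free ?col_base_full.
exists (\rank B), (submxrow (row_base B)), (submxcol (col_base B)); split.
  by rewrite -mul_mxrow_mxcol submxrowK submxcolK.
move=> k l; have /eq_mxblockP/(_ k l) // :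
  \mxblock_(i, j) (submxcol (col_base B) i *m submxrow (row_base B) j)
    = \mxblock_(i, j) E i j.
by rewrite -mul_mxcol_mxrow submxrowK submxcolK mulmx_base.
Qed.

(** The product is a parameter so that the opposite product is covered too; linearity and
    multiplicativity are required on all of [A]. *)
Definition algrep (K : fieldType) (A : falgType K) (mul : A -> A -> A)
    (I : {vspace A}) n (r : A -> 'M[K]_n) :=
  [/\ linear r, forall x y, r (mul x y) = r x *m r y, r 1 = 1%:M &
      forall x, x \in I -> r x = 0].

Definition blockrep (K : fieldType) (A : falgType K) m d r
    (Q : 'I_m -> 'M[K]_(r, d)) (P : 'I_m -> 'M[K]_(d, r))
    (h : 'I_m -> 'I_m -> A -> 'M[K]_d) (a : A) : 'M[K]_r :=
  \sum_k \sum_l Q k *m h k l a *m P l.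

(* [blockrep] is the action of the blocks [h k l a] on the image of the block
   idempotent [h k l 1], factored as [P k *m Q l]. *)
Section BlockRep.
Variables (K : fieldType) (A : falgType K) (mul : A -> A -> A) (I : {vspace A}).
Variables (m d : nat) (h : 'I_m -> 'I_m -> A -> 'M[K]_d).
Hypothesis mulx1 : forall x, mul x 1 = x.
Hypothesis mul1x : forall x, mul 1 x = x.
Hypothesis hM : forall k l a b, \sum_j h k j a *m h j l b = h k l (mul a b).

Section QP.
Variables (r : nat) (Q : 'I_m -> 'M[K]_(r, d)) (P : 'I_m -> 'M[K]_(d, r)).
Hypothesis PQ : forall k l, P k *m Q l = h k l 1.

Lemma mul_P_blockrep k a : P k *m blockrep Q P h a = \sum_l h k l a *m P l.
Proof.
rewrite /blockrep mulmx_sumr; under eq_bigr do rewrite mulmx_sumr.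
rewrite exchange_big; apply: eq_bigr => l _ /=.
under eq_bigr do rewrite !mulmxA PQ.
by rewrite -mulmx_suml hM mul1x.
Qed.

Lemma mul_blockrep_Q l a : blockrep Q P h a *m Q l = \sum_k Q k *m h k l a.
Proof.
rewrite /blockrep mulmx_suml; apply: eq_bigr => k _; rewrite mulmx_suml.
under eq_bigr do rewrite -!mulmxA PQ.
by rewrite -mulmx_sumr hM mulx1.
Qed.
End QP.

Hypothesis hL : forall k l, linear (h k l).
Hypothesis hI : forall k l x, x \in I -> h k l x = 0.

Lemma blockrep_exists :
  exists r (Q : 'I_m -> 'M[K]_(r, d)) (P : 'I_m -> 'M[K]_(d, r)),
  [/\ \sum_k Q k *m P k = 1%:M, forall k l, P k *m Q l = h k l 1 &
      algrep mul I (blockrep Q P h)].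
Proof.
have [|r [Q [P [QP PQ]]]] := @split_block_idempotent K m d (fun k l => h k l 1).
  by move=> k l; rewrite hM mulx1.
exists r, Q, P; split=> //; split.
- move=> a x y; rewrite /blockrep scaler_sumr -big_split; apply: eq_bigr => k _.
  rewrite scaler_sumr -big_split; apply: eq_bigr => l _ /=.
  by rewrite hL mulmxDr mulmxDl -scalemxAr -scalemxAl.
- move=> x y; rewrite {2}/blockrep mulmx_suml; apply: eq_bigr => k _.
  rewrite mulmx_suml; under [RHS]eq_bigr do rewrite -mulmxA (mul_P_blockrep PQ).
  under [RHS]eq_bigr do rewrite mulmx_sumr.
  rewrite exchange_big; apply: eq_bigr => l _ /=.
  by rewrite -hM mulmx_sumr mulmx_suml; apply: eq_bigr => j _; rewrite !mulmxA.
(* Since [h k l 1] is [P k *m Q l], the action of 1 is the square of [\sum_k Q k *m P k]. *)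
- transitivity ((\sum_k Q k *m P k) *m (\sum_k Q k *m P k)); last first.
    by rewrite QP mulmx1.
  rewrite /blockrep mulmx_suml; apply: eq_bigr => k _; rewrite mulmx_sumr.
  by apply: eq_bigr => l _; rewrite -PQ !mulmxA.
- move=> x Ix; rewrite /blockrep big1 // => k _; rewrite big1 // => l _.
  by rewrite hI // mulmx0 mul0mx.
Qed.

End BlockRep.

(** * Dual bases of projective ideals *)

Section CoordinateMatrix.
Import VectorInternalTheory.
Variables (K : fieldType) (V : vectType K) (n : nat).
Implicit Type phi : V -> 'rV[K]_n.

(** Modules are given by matrices, so the regular module and the maps out of it are written in the
    internal coordinates [v2r]. *)
Definition coord_mx phi : 'M[K]_(dim V, n) :=
  \matrix_i phi (r2v (delta_mx 0 i)).

Lemma mul_coord_mx phi x : linear phi -> v2r x *m coord_mx phi = phi x.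
Proof.
move=> phi_lin.
pose phiL : {linear V -> 'rV[K]_n} :=
  HB.pack phi (GRing.isLinear.Build _ _ _ _ phi phi_lin).
rewrite mulmx_sum_row -[in RHS](v2rK x) [in RHS](row_sum_delta (v2r x)).
rewrite -[phi _]/(phiL _) !linear_sum; apply: eq_bigr => i _.
by rewrite !linearZ /= rowK.
Qed.

Lemma v2r_mx_inj (M N : 'M[K]_(dim V, n)) :
  (forall x, v2r x *m M = v2r x *m N) -> M = N.
Proof.
by move=> e; apply/row_matrixP=> i; rewrite !rowE -(r2vK (delta_mx 0 i)) e.
Qed.

End CoordinateMatrix.

(* [mul] is the product of [A] or the opposite product: this treats right and
   left modules at once, both as row vectors. *)
Section DualBasis.
Import VectorInternalTheory.
Variables (K : fieldType) (A : falgType K) (mul : A -> A -> A).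
Variables (J J' : {vspace A}).
Hypothesis mul_linl : forall a, linear (mul a).
Hypothesis mul_linr : forall a, linear (mul^~ a).
Hypothesis mulA : associative mul.
Hypothesis mulx1 : forall x, mul x 1 = x.
Hypothesis mul1x : forall x, mul 1 x = x.
Hypothesis J_mul : forall x a, x \in J -> mul x a \in J.
Hypothesis mul_J : forall x a, x \in J -> mul a x \in J.
Hypothesis JJ' : (J <= J')%VS.
Hypothesis J'_mul : forall x a, x \in J' -> mul x a \in J'.
Variables (d : nat) (r : A -> 'M[K]_d) (pi : A -> 'rV[K]_d).
Hypothesis pi_lin : linear_on (fun a (v : 'rV[K]_d) => a *: v) J' pi.
Hypothesis pi_surj : forall v, exists2 u, u \in J' & pi u = v.
Hypothesis pi_ker : forall u, u \in J' -> (pi u = 0 <-> u \in J).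
Hypothesis pi_act : forall x u, u \in J' -> pi (mul u x) = pi u *m r x.
Hypothesis lift : forall n (r' : A -> 'M[K]_n) (g : 'M[K]_(n, d)),
  algrep mul J r' -> (forall x, r' x *m g = g *m r x) -> \rank g = d ->
  exists h : 'M[K]_(d, n), (forall x, r x *m h = h *m r' x) /\ h *m g = 1%:M.
Variables (f : A) (m : nat) (v : 'I_m -> A).
Hypothesis ff : mul f f = f.
Hypothesis v_J' : forall k, v k \in J'.
Hypothesis vf : forall k, mul (v k) f = v k.
Hypothesis v_span : forall z, z \in J' -> exists b, z = \sum_k mul (v k) (b k).

(** The quotient by [J] is modelled inside [A]: [p] is a projection with kernel [J], and its image
    represents A/J. *)
Let p x := x - projv J x.
Let p_lin : linear p.
Proof. by move=> a x y; rewrite /p linearP opprD addrACA scalerBr. Qed.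
Let pP x : x - p x \in J.
Proof. by rewrite /p opprB addrC subrK memv_proj. Qed.
Let p_eq x y : x - y \in J -> p x = p y.
Proof.
move=> Jxy; apply/eqP; rewrite -subr_eq0 addrC -scaleN1r -p_lin scaleN1r addrC.
by rewrite /p projv_id // subrr.
Qed.
Let mulBl a x y : mul (x - y) a = mul x a - mul y a.
Proof.
by have := mul_linr a (-1) y x; rewrite !scaleN1r ![- _ + _]addrC.
Qed.
Let mulBr a x y : mul a (x - y) = mul a x - mul a y.
Proof.
by have := mul_linl a (-1) y x; rewrite !scaleN1r ![- _ + _]addrC.
Qed.
Let p_mul x a : p (mul (p x) a) = p (mul x a).
Proof. by apply/esym/p_eq; rewrite -mulBl J_mul. Qed.

Let pmx := coord_mx (v2r \o p).
Let pmxE x : v2r x *m pmx = v2r (p x).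
Proof. by rewrite mul_coord_mx // => a y z /=; rewrite p_lin linearP. Qed.
Let Rmx a := coord_mx (fun x => v2r (mul x a)).
Let RmxE x a : v2r x *m Rmx a = v2r (mul x a).
Proof. by rewrite mul_coord_mx // => c y z /=; rewrite mul_linr linearP. Qed.
(** The regular module of A/J, extended by zero to the coordinate space of [A]. It is not unital
    there: 1 acts as the idempotent [pmx]. *)
Let reg a := pmx *m Rmx a *m pmx.
Let regE x a : v2r x *m reg a = v2r (p (mul x a)).
Proof. by rewrite /reg !mulmxA pmxE RmxE pmxE p_mul. Qed.
Let reg_lin : linear reg.
Proof.
move=> c a b; apply: v2r_mx_inj => x.
by rewrite mulmxDr -scalemxAr !regE mul_linl p_lin linearP.
Qed.
Let regM a b : reg a *m reg b = reg (mul a b).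
Proof. by apply: v2r_mx_inj => x; rewrite mulmxA !regE p_mul mulA. Qed.
Let reg1 : reg 1 = pmx.
Proof. by apply: v2r_mx_inj => x; rewrite regE pmxE mulx1. Qed.
Let reg_J x : x \in J -> reg x = 0.
Proof.
move=> Jx; apply: v2r_mx_inj => y; rewrite regE mulmx0.
by rewrite /p projv_id ?mul_J // subrr linear0.
Qed.

Let G k : 'M[K]_(dim A, d) := coord_mx (fun a => pi (mul (v k) a)).
Let GE k x : v2r x *m G k = pi (mul (v k) x).
Proof.
by rewrite mul_coord_mx // => c y z; rewrite mul_linl pi_lin ?J'_mul.
Qed.

Let pi0 : pi 0 = 0. Proof. by apply/pi_ker; rewrite mem0v. Qed.
Let piD x y : x \in J' -> y \in J' -> pi (x + y) = pi x + pi y.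
Proof. by move=> Jx Jy; rewrite -{1}[x]scale1r pi_lin // scale1r. Qed.
Let piB x y : x \in J' -> y \in J' -> pi (x - y) = pi x - pi y.
Proof. by move=> Jx Jy; rewrite addrC -scaleN1r pi_lin // scaleN1r addrC. Qed.
Let pi_sum (F : 'I_m -> A) : (forall k, F k \in J') ->
  pi (\sum_k F k) = \sum_k pi (F k).
Proof.
move=> FJ; elim: (index_enum _) => [|k s IHs]; first by rewrite !big_nil.
by rewrite !big_cons piD ?IHs // rpred_sum.
Qed.
Let pi_eq x y : x \in J' -> y \in J' -> x - y \in J -> pi x = pi y.
Proof.
move=> Jx Jy Jxy; apply/eqP; rewrite -subr_eq0 -piB //.
by apply/eqP/pi_ker; rewrite ?(subvP JJ').
Qed.

(** Dual basis lemma: the surjection from the free module (A/J)^m onto J'/J given by the [v k]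
    splits by projectivity, and [t k] is the k-th coordinate of the splitting. Multiplying it by [f]
    costs nothing because [v k] absorbs [f]. *)
Lemma projective_dual_basis : exists t : 'I_m -> 'End(A),
  [/\ forall k z a, z \in J' -> t k (mul z a) - mul (t k z) a \in J,
      forall k z, z \in J -> t k z \in J,
      forall k z, mul f (t k z) = t k z &
      forall z, z \in J' -> z - \sum_k mul (v k) (t k z) \in J].
Proof.
(* Diagonal blocks, that is, m copies of the regular module; splitting the idempotent action of 1
   yields a unital model of (A/J)^m. *)
pose h (k l : 'I_m) a := (k == l)%:R *: reg a.
have hM k l a b : \sum_j h k j a *m h j l b = h k l (mul a b).
  rewrite (bigD1 k) //= big1 ?addr0 => [|j /negbTE nkj].
    by rewrite /h eqxx scale1r -scalemxAr regM.
  by rewrite /h eq_sym nkj scale0r mul0mx.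
have hL k l : linear (h k l).
  by move=> c a b; rewrite /h reg_lin scalerDr !scalerA mulrC.
have hJ k l x : x \in J -> h k l x = 0 by move=> Jx; rewrite /h reg_J // scaler0.
have [n [Q [P [QP PQ Nrep]]]] := blockrep_exists mulx1 mul1x hM hL hJ.
pose r' := blockrep Q P h.
(* The map sending a tuple [a] to the class of the sum of the [mul (v k) (a k)]. *)
pose g := \sum_k Q k *m G k.
have Pg k : P k *m g = G k.
  rewrite mulmx_sumr (bigD1 k) //= big1 ?addr0 => [|j /negbTE nkj].
    rewrite mulmxA PQ /h eqxx scale1r reg1; apply: v2r_mx_inj => x.
    rewrite mulmxA pmxE !GE; apply: pi_eq; rewrite ?J'_mul //.
    by rewrite -mulBr mul_J // -opprB rpredN.
  by rewrite mulmxA PQ /h eq_sym nkj scale0r mul0mx.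
have r'g x : r' x *m g = g *m r x.
  rewrite /g mulmx_suml mulmx_sumr.
  under eq_bigr do rewrite mulmxA (mul_blockrep_Q mulx1 hM PQ) mulmx_suml.
  rewrite exchange_big; apply: eq_bigr => k _ /=.
  rewrite (bigD1 k) //= big1 ?addr0 => [|j /negbTE nkj]; last first.
    by rewrite /h eq_sym nkj scale0r mulmx0 mul0mx.
  rewrite /h eqxx scale1r -[LHS]mulmxA -[RHS]mulmxA.
  congr (_ *m _); apply: v2r_mx_inj => y.
  rewrite mulmxA regE [RHS]mulmxA !GE -pi_act // ?J'_mul // -mulA.
  apply: pi_eq; rewrite ?J'_mul // -mulBr mul_J // -opprB rpredN //.
(* Each basis row is [pi u] for some [u] in [J']; expanding [u] by [v_span] puts it in the row space
   of [g]. *)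
have rg : \rank g = d.
  apply/eqP; rewrite -[_ == _]/(row_full g) -sub1mx; apply/row_subP => i.
  have [u Ju <-] := pi_surj (row i 1%:M); have [b ->] := v_span Ju.
  rewrite pi_sum => [|k]; last exact: J'_mul.
  apply: summx_sub => k _; rewrite -GE -Pg mulmxA; exact: submxMl.
have [s [sr sg]] := lift Nrep r'g rg.
have [piH piHE] := linear_on_ext pi_lin.
pose t0 k z : A := mul f (r2v (piH z *m s *m Q k)).
have t0_lin k : linear (t0 k).
  by move=> c y z; rewrite /t0 linearP !mulmxDl -!scalemxAl linearP mul_linl.
pose tL k : {linear A -> A} :=
  HB.pack (t0 k) (GRing.isLinear.Build _ _ _ _ (t0 k) (t0_lin k)).
have tE k z : linfun (tL k) z = t0 k z by rewrite lfunE.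
exists (fun k => linfun (tL k)); split.
- move=> k z a Jz; rewrite !tE /t0 -mulA -mulBr mul_J //.
  rewrite -piHE ?J'_mul // pi_act // -[pi z *m r a *m s]mulmxA sr mulmxA.
  rewrite -[_ *m r' a *m Q k]mulmxA.
  rewrite (mul_blockrep_Q mulx1 hM PQ) (bigD1 k) //= big1 ?addr0; last first.
    by move=> j /negbTE nkj; rewrite /h nkj scale0r mulmx0.
  rewrite /h eqxx scale1r mulmxA -piHE // -[_ *m Q k]r2vK regE v2rK.
  by rewrite r2vK -opprB rpredN.
- move=> k z Jz; rewrite tE /t0 -piHE ?(subvP JJ') //.
  by rewrite (pi_ker _).2 ?(subvP JJ') // !mul0mx linear0 mul_J ?mem0v.
- by move=> k z; rewrite tE /t0 mulA ff.
- move=> z Jz; have vJ k a : mul (v k) a \in J' by rewrite J'_mul.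
  apply/pi_ker; rewrite ?rpredB ?rpred_sum // piB ?rpred_sum // pi_sum //.
  apply/eqP; rewrite subr_eq0; apply/eqP.
  under eq_bigr do rewrite tE /t0 mulA vf -GE r2vK -[_ *m G _]mulmxA.
  by rewrite -mulmx_sumr -/g -piHE // -mulmxA sg mulmx1.
Qed.

End DualBasis.

(** * Corners, two-sided ideals and dual bases of AfA modulo J *)

Section Corner.
Variables (K : fieldType) (A : falgType K).
Implicit Types (f x y z : A) (U V : {vspace A}).

Lemma corner1 : corner (1 : A) = fullv.
Proof. by rewrite /corner prod1v prodv1. Qed.

Lemma mem_lcorner f x : f * f = f -> (x \in lcorner f) = (x * f == x).
Proof.
move=> ff; apply/memv_cosetP/eqP => [[u _ ->]|<-]; first by rewrite -mulrA ff.
by exists x; rewrite ?memvf.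
Qed.

Lemma mem_rcorner f x : f * f = f -> (x \in (<[f]> * fullv)%VS) = (f * x == x).
Proof.
move=> ff; apply/idP/eqP => [|<-]; last by rewrite memv_mul ?memv_line ?memvf.
have le : (<[f]> * fullv <= lker (amull f - \1%VF))%VS.
  apply/prodvP => y z /vlineP[e ->] _; rewrite memv_ker !lfunE /= !lfunE /= !lfunE.
  by rewrite -!scalerAl -scalerAr mulrA ff subrr.
move=> /(subvP le); rewrite memv_ker !lfunE /= !lfunE /= !lfunE subr_eq0.
by move/eqP.
Qed.

Lemma mem_corner f x : f * f = f -> (x \in corner f) = (f * x * f == x).
Proof.
move=> ff; apply/idP/eqP => [|<-]; last by rewrite !memv_mul ?memv_line ?memvf.
case/memv_cosetP=> y; rewrite mem_rcorner // => /eqP fy ->.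
by rewrite mulrA fy -mulrA ff.
Qed.

Lemma corner_unit f x : f * f = f -> x \in corner f -> f * x = x /\ x * f = x.
Proof.
move=> ff; rewrite mem_corner // => /eqP e.
by split; rewrite -{1}e ?mulrA ?ff // -!mulrA ff mulrA.
Qed.

Lemma corner_mul f x y : f * f = f ->
  x \in corner f -> y \in corner f -> x * y \in corner f.
Proof.
move=> ff /(corner_unit ff)[fx _] /(corner_unit ff)[_ yf].
by rewrite mem_corner // mulrA fx -mulrA yf.
Qed.

Definition ideal2 (J : {vspace A}) :=
  forall a x : A, x \in J -> a * x \in J /\ x * a \in J.

Lemma ideal2_gen (X : {vspace A}) : ideal2 (fullv * X * fullv)%VS.
Proof.
move=> a x Jx; split.
  have: a * x \in (fullv * (fullv * X * fullv))%VS by rewrite memv_mul ?memvf.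
  rewrite !prodvA; apply/subvP; do 2!apply: prodvSl; exact: subvf.
have: x * a \in (fullv * X * fullv * fullv)%VS by rewrite memv_mul ?memvf.
rewrite -[(_ * _ * _ * _)%VS]prodvA; apply/subvP/prodvSr; exact: subvf.
Qed.

(** The sum of the spaces xV, for x in the basis of [U], contains every product. The family of left
    factors depends only on [U], so one generating family serves all [z]. *)
Lemma mem_prodv_basisl U V z : z \in (U * V)%VS ->
  exists2 b : 'I_(\dim U) -> A,
    forall k, b k \in V & z = \sum_(k < \dim U) (vbasis U)`_k * b k.
Proof.
pose W := (\sum_(k < \dim U) (amull (vbasis U)`_k @: V))%VS.
have sW : (U * V <= W)%VS.
  apply/prodvP => x y Ux Vy; rewrite (coord_vbasis Ux) mulr_suml.
  apply: rpred_sum => k _; apply/(subvP (sumv_sup k (isT : xpredT k) (subvv _))).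
  by rewrite -scalerAl rpredZ //; apply/memv_imgP; exists y; rewrite ?lfunE.
move=> /(subvP sW) /memv_sumP[w Ww ->].
have /fin_all_exists2[b bV bE] (k : 'I_ _) :
    exists2 b, b \in V & w k = (vbasis U)`_k * b.
  by have /memv_imgP[b Vb ->] := Ww k isT; exists b; rewrite ?lfunE.
by exists b => //; apply: eq_bigr => k _.
Qed.

Lemma mem_prodv_basisr U V z : z \in (U * V)%VS ->
  exists2 b : 'I_(\dim V) -> A,
    forall k, b k \in U & z = \sum_(k < \dim V) b k * (vbasis V)`_k.
Proof.
pose W := (\sum_(k < \dim V) (amulr (vbasis V)`_k @: U))%VS.
have sW : (U * V <= W)%VS.
  apply/prodvP => x y Ux Vy; rewrite (coord_vbasis Vy) mulr_sumr.
  apply: rpred_sum => k _; apply/(subvP (sumv_sup k (isT : xpredT k) (subvv _))).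
  by rewrite -scalerAr rpredZ //; apply/memv_imgP; exists x; rewrite ?lfunE.
move=> /(subvP sW) /memv_sumP[w Ww ->].
have /fin_all_exists2[b bV bE] (k : 'I_ _) :
    exists2 b, b \in U & w k = b * (vbasis V)`_k.
  by have /memv_imgP[b Vb ->] := Ww k isT; exists b; rewrite ?lfunE.
by exists b => //; apply: eq_bigr => k _.
Qed.

Variables (f : A) (J : {vspace A}).
Hypotheses (ff : f * f = f) (Jid : ideal2 J).
Let J' := (fullv * <[f]> * fullv)%VS.
Hypothesis JJ' : (J <= J')%VS.

(** A basis of Af generates AfA as a right module, so the dual basis lemma applies with the product
    of [A]. *)
Lemma right_dual_basis : rproj_subquot 1 J J' J ->
  exists m (v : 'I_m -> A) (t : 'I_m -> 'End(A)),
  [/\ forall k, v k * f = v k,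
      forall k z a, z \in J' -> t k (z * a) - t k z * a \in J,
      forall k z, z \in J -> t k z \in J,
      forall k z, f * t k z = t k z &
      forall z, z \in J' -> z - \sum_k v k * t k z \in J].
Proof.
case=> M [[Mlin MM M1 MJ] [pi [pi_lin pi_surj pi_ker pi_act]] Mproj].
pose v (k : 'I_(\dim (lcorner f))) := (vbasis (lcorner f))`_k.
exists _, v; have v_l k : v k \in lcorner f.
  by rewrite vbasis_mem // mem_nth // size_tuple.
have vf k : v k * f = v k by apply/eqP; rewrite -mem_lcorner.
have v_span z : z \in J' -> exists b, z = \sum_k v k * b k.
  by case/mem_prodv_basisl=> b _ ->; exists b.
have J'id : ideal2 J' by apply: ideal2_gen.
have vJ' k : v k \in J'.
  by rewrite -[v k]mulr1 memv_mul ?memvf.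
have [|||||||t [t1 t2 t3 t4]] := @projective_dual_basis K A *%R J J' _ _
  (@mulrA _) (@mulr1 _) (@mul1r _) _ _ JJ' _ _ (ract M) pi pi_lin pi_surj
  pi_ker _ _ f _ v ff vJ' vf v_span.
- by move=> a c x y; rewrite mulrDr scalerAr.
- by move=> a c x y; rewrite mulrDl scalerAl.
- by move=> x a /(Jid a)[].
- by move=> x a /(Jid a)[].
- by move=> x a /(J'id a)[].
- by move=> x u Ju; apply: pi_act; rewrite // corner1 memvf.
- move=> n r' g [r'_lin r'M r'1 r'J] r'g rg.
  have N_rep : is_rep 1 J (Rep r').
    by split=> [c x y _ _|x y _ _||] //=; rewrite ?r'_lin ?r'M.
  have [h [hE hg]] := Mproj (Rep r') g N_rep (fun x _ => r'g x) rg.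
  by exists h; split=> // x; apply: hE; rewrite corner1 memvf.
by exists t.
Qed.

(** The same argument for the opposite product: transposition turns column vectors with a left
    action into row vectors, and a basis of fA is the generating family. *)
Lemma left_dual_basis : lproj_subquot 1 J J' J ->
  exists m (u : 'I_m -> A) (s : 'I_m -> 'End(A)),
  [/\ forall k, f * u k = u k,
      forall k z a, z \in J' -> s k (a * z) - a * s k z \in J,
      forall k z, z \in J -> s k z \in J,
      forall k z, s k z * f = s k z &
      forall z, z \in J' -> z - \sum_k s k z * u k \in J].
Proof.
case=> M [[Mlin MM M1 MJ] [pi [pi_lin pi_surj pi_ker pi_act]] Mproj].
pose u (k : 'I_(\dim (<[f]> * fullv))) := (vbasis (<[f]> * fullv)%VS)`_k.
exists _, u; have u_r k : u k \in (<[f]> * fullv)%VS.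
  by rewrite vbasis_mem // mem_nth // size_tuple.
have fu k : f * u k = u k by apply/eqP; rewrite -mem_rcorner.
have u_span z : z \in J' -> exists b, z = \sum_k b k * u k.
  by rewrite /J' -prodvA => /mem_prodv_basisr[b _ ->]; exists b.
have J'id : ideal2 J' by apply: ideal2_gen.
have uJ' k : u k \in J'.
  by rewrite -[u k]mul1r /J' -prodvA memv_mul ?memvf.
have [|||||||||||s [s1 s2 s3 s4]] := 
  @projective_dual_basis K A (fun x y => y * x) J J' _ _ _ (@mul1r _) (@mulr1 _) _ _
  JJ' _ _ (fun x => (ract M x)^T) (fun x => (pi x)^T)
  _ _ _ _ _ f _ u ff uJ' fu u_span.
- by move=> a c x y; rewrite mulrDl scalerAl.
- by move=> a c x y; rewrite mulrDr scalerAr.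
- by move=> x y z; rewrite mulrA.
- by move=> x a /(Jid a)[].
- by move=> x a /(Jid a)[].
- by move=> x a /(J'id a)[].
- by move=> c x y Jx Jy; rewrite pi_lin // linearP.
- by move=> w; have [x Jx xE] := pi_surj w^T; exists x; rewrite // xE trmxK.
- move=> x Jx; split=> [/(congr1 trmx)|/(pi_ker _ Jx) ->]; last exact: trmx0.
  by rewrite trmxK trmx0 => /(pi_ker _ Jx).
- by move=> x z Jz; rewrite pi_act ?trmx_mul // corner1 memvf.
- move=> n r' g [r'_lin r'M r'1 r'J] r'g rg.
  pose N := Rep (fun x => (r' x)^T).
  have N_rep : is_rep 1 J N.
    split=> [c x y _ _|x y _ _||x Jx] /=.
    - by rewrite r'_lin linearP.
    - by rewrite r'M trmx_mul.
    - by rewrite r'1 trmx1.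
    - by rewrite r'J // trmx0.
  have gN x : x \in corner 1 -> g^T *m ract N x = ract M x *m g^T.
    by rewrite -trmx_mul r'g trmx_mul trmxK.
  have [|h [hE hg]] := Mproj N g^T N_rep gN; first by rewrite mxrank_tr.
  exists h^T; split=> [x|]; last by rewrite -[g]trmxK -trmx_mul hg trmx1.
  by rewrite -trmx_mul hE ?corner1 ?memvf //= trmx_mul trmxK.
by exists s.
Qed.

End Corner.

(** * One layer of the chain *)

Section Layer.
Variables (K : fieldType) (A : falgType K) (f : A) (J : {vspace A}).
Hypotheses (ff : f * f = f) (Jid : ideal2 J).
Let J' := (fullv * <[f]> * fullv)%VS.
Hypothesis JJ' : (J <= J')%VS.
Variables (m m' : nat) (v : 'I_m -> A) (t : 'I_m -> 'End(A)).
Variables (u : 'I_m' -> A) (s : 'I_m' -> 'End(A)).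
Hypothesis vf : forall k, v k * f = v k.
Hypothesis t_mulr : forall k z a, z \in J' -> t k (z * a) - t k z * a \in J.
Hypothesis t_J : forall k z, z \in J -> t k z \in J.
Hypothesis ft : forall k z, f * t k z = t k z.
Hypothesis t_gen : forall z, z \in J' -> z - \sum_k v k * t k z \in J.
Hypothesis fu : forall k, f * u k = u k.
Hypothesis s_mull : forall k z a, z \in J' -> s k (a * z) - a * s k z \in J.
Hypothesis s_J : forall k z, z \in J -> s k z \in J.
Hypothesis sf : forall k z, s k z * f = s k z.
Hypothesis s_gen : forall z, z \in J' -> z - \sum_k s k z * u k \in J.

Local Notation "x =J y" := (x - y \in J) (at level 70).

Let Jrefl x : x =J x. Proof. by rewrite subrr mem0v. Qed.
Let Jtrans y x z : x =J y -> y =J z -> x =J z.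
Proof. by move=> xy yz; rewrite -(subrKA y) rpredD. Qed.
Let JMl a x y : x =J y -> a * x =J a * y.
Proof. by rewrite -mulrBr => /(Jid a)[]. Qed.
Let JMr a x y : x =J y -> x * a =J y * a.
Proof. by rewrite -mulrBl => /(Jid a)[]. Qed.
Let Jsum (I : finType) (F G : I -> A) :
  (forall i, F i =J G i) -> \sum_i F i =J \sum_i G i.
Proof. by move=> FG; rewrite -sumrB rpred_sum. Qed.
Let Jt k x y : x =J y -> t k x =J t k y.
Proof. by rewrite -linearB; apply: t_J. Qed.
Let Js k x y : x =J y -> s k x =J s k y.
Proof. by rewrite -linearB; apply: s_J. Qed.

Let J'id : ideal2 J'. Proof. exact: ideal2_gen. Qed.
Let J'Ml a x : x \in J' -> a * x \in J'. Proof. by case/(J'id a). Qed.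
Let J'Mr a x : x \in J' -> x * a \in J'. Proof. by case/(J'id a). Qed.
Let fJ' : f \in J'.
Proof. by rewrite -[f]mulr1 -[f]mul1r !memv_mul ?memvf ?memv_line. Qed.
Let J'f x : x * f = x -> x \in J'. Proof. by move<-; apply: J'Ml. Qed.
Let fJ'l x : f * x = x -> x \in J'. Proof. by move<-; apply: J'Mr. Qed.
Let vJ' k : v k \in J'. Proof. exact: J'f. Qed.
Let uJ' k : u k \in J'. Proof. exact: fJ'l. Qed.
Let sJ' k z : s k z \in J'. Proof. exact: J'f. Qed.

(** The extra factor [f] places the coefficients exactly in fAf. On y in Af, on z in fA and on every
    s_j(z), it changes the coefficient only modulo [J]. *)
Definition lcoef k y : A := t k y * f.
Definition rcoef k y : A := f * s k y.
Definition bicoef i j z : A := t i (s j z) * f.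

Lemma lcoef_corner k y : lcoef k y \in corner f.
Proof. by rewrite mem_corner // /lcoef mulrA ft -mulrA ff. Qed.
Lemma rcoef_corner k y : rcoef k y \in corner f.
Proof. by rewrite mem_corner // /rcoef mulrA ff -mulrA sf. Qed.
Lemma bicoef_corner i j z : bicoef i j z \in corner f.
Proof. exact: lcoef_corner. Qed.

Lemma lcoef_linear k : linear (lcoef k).
Proof. by move=> a x y; rewrite /lcoef linearP mulrDl scalerAl. Qed.
Lemma rcoef_linear k : linear (rcoef k).
Proof. by move=> a x y; rewrite /rcoef linearP mulrDr scalerAr. Qed.
Lemma bicoef_linear i j : linear (bicoef i j).
Proof. by move=> a x y; rewrite /bicoef !linearP mulrDl scalerAl. Qed.

Let cornerE x : x \in corner f -> f * x = x /\ x * f = x.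
Proof. exact: corner_unit. Qed.
Let cornerM x y : x \in corner f -> y \in corner f -> x * y \in corner f.
Proof. exact: corner_mul. Qed.

(** The maps [t k] are right linear only; expanding [z] in the [v l] shows that left multiplication
    by [x] acts on coordinates through the matrix [t k (x * v l)]. *)
Let t_mull k x z : z \in J' -> t k (x * z) =J \sum_l t k (x * v l) * t l z.
Proof.
move=> J'z; apply: (Jtrans (Jt k (JMl x (t_gen J'z)))).
rewrite mulr_sumr linear_sum; apply: Jsum => l.
by rewrite mulrA; apply/t_mulr/J'Ml.
Qed.

Let s_mulr k x z : z \in J' -> s k (z * x) =J \sum_l s l z * s k (u l * x).
Proof.
move=> J'z; apply: (Jtrans (Js k (JMr x (s_gen J'z)))).
rewrite mulr_suml linear_sum; apply: Jsum => l.
by rewrite -mulrA; apply/s_mull/J'Mr.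
Qed.

Lemma lcoef_mull k x z : z \in J' ->
  lcoef k (x * z) =J \sum_l lcoef k (x * v l) * lcoef l z.
Proof.
move=> J'z; apply: (Jtrans (JMr f (t_mull k x J'z))).
rewrite mulr_suml; apply: Jsum => l.
by rewrite /lcoef -[_ * f * _]mulrA (mulrA f) ft mulrA.
Qed.

Lemma rcoef_mulr k x z : z \in J' ->
  rcoef k (z * x) =J \sum_l rcoef l z * rcoef k (u l * x).
Proof.
move=> J'z; apply: (Jtrans (JMl f (s_mulr k x J'z))).
rewrite mulr_sumr; apply: Jsum => l.
by rewrite /rcoef !mulrA -[f * _ * f]mulrA sf.
Qed.

Lemma lcoef_mulr k z b : z \in J' -> b \in corner f ->
  lcoef k (z * b) =J lcoef k z * b.
Proof.
move=> J'z /cornerE[fb bf]; apply: (Jtrans (JMr f (t_mulr k b J'z))).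
by rewrite /lcoef -!mulrA fb bf.
Qed.

Lemma lcoef_gen z : z * f = z -> z =J \sum_k v k * lcoef k z.
Proof.
move=> zf; have := JMr f (t_gen (J'f zf)); rewrite zf mulr_suml => /Jtrans; apply.
by apply: Jsum => k; rewrite /lcoef mulrA.
Qed.

Lemma bicoef_J i j z : z \in J -> bicoef i j z \in J.
Proof. by move=> Jz; case: (Jid f (t_J i (s_J j Jz))). Qed.

(** The intertwining property: modulo [J], left and right multiplication on AfA become
    multiplication of the coefficient matrix by matrices over fAf. *)
Lemma bicoef_mul i j a z b : z \in J' ->
  bicoef i j (a * z * b)
    =J \sum_k \sum_l lcoef i (a * v k) * bicoef k l z * rcoef j (u l * b).
Proof.
move=> J'z.
(* First [a] leaves [s] by left linearity and [b] is absorbed into a matrix; afterwards [t] is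
   treated symmetrically. *)
have e1 : s j (a * z * b) =J \sum_l a * s l z * s j (u l * b).
  rewrite -mulrA; apply: Jtrans (s_mull j a (J'Mr b J'z)) _.
  apply: Jtrans (JMl a (s_mulr j b J'z)) _.
  by rewrite mulr_sumr; apply: Jsum => l; rewrite mulrA.
apply: (Jtrans (JMr f (Jt i e1))).
rewrite exchange_big linear_sum mulr_suml; apply: Jsum => l.
have e2 := t_mulr i (s j (u l * b)) (J'Ml a (sJ' l z)).
apply: (Jtrans (JMr f e2)).
apply: (Jtrans (JMr f (JMr _ (t_mull i a (sJ' l z))))).
rewrite !mulr_suml; apply: Jsum => k.
have e3 := t_mulr k f (sJ' l z); rewrite sf in e3.
rewrite -[_ * f]mulrA sf.
apply: (Jtrans (JMr _ (JMl _ e3))).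
by rewrite /bicoef /lcoef /rcoef -!mulrA (mulrA f (t _ _)) ft (mulrA f f) ff.
Qed.

(** For [x] in the corner the coefficient matrix is a column times [x] times a row; hence the
    generators of AXA have coefficients in every ideal containing [x]. *)
Lemma bicoef_sandwich i j a x b : x \in corner f ->
  bicoef i j (a * x * b) =J lcoef i (a * f) * x * rcoef j (f * b).
Proof.
move=> /cornerE[fx xf].
have e1 : s j (a * x * b) =J a * f * (x * s j (f * b)).
  have -> : a * x * b = a * x * (f * b) by rewrite !mulrA -(mulrA a x f) xf.
  apply: Jtrans (s_mull j (a * x) _) _; first by rewrite fJ'l // mulrA ff.
  by rewrite -!mulrA (mulrA f x) fx.
apply: (Jtrans (JMr f (Jt i e1))).
apply: (Jtrans (JMr f (t_mulr i _ (J'Ml a fJ')))).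
by rewrite /lcoef /rcoef -!mulrA sf (mulrA f x) fx (mulrA x f) xf.
Qed.

Lemma bicoef_gen z : z \in J' -> z =J \sum_k \sum_l v k * bicoef k l z * u l.
Proof.
move=> J'z; apply: Jtrans (s_gen J'z) _.
rewrite exchange_big; apply: Jsum => l.
apply: (Jtrans (JMr _ (t_gen (sJ' l z)))); rewrite mulr_suml.
by apply: Jsum => k; rewrite /bicoef -!mulrA fu.
Qed.

Local Notation I := (corner f :&: J)%VS.
Definition ext_ideal (X : {vspace A}) : {vspace A} := (J + fullv * X * fullv)%VS.

Let ideal_absorb X a x b : ideal_of f X -> a \in corner f -> x \in X ->
  b \in corner f -> a * x * b \in X.
Proof.
case=> _ XL XR ca Xx cb; apply/(subvP XR)/memv_mul => //.
by apply/(subvP XL)/memv_mul.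
Qed.

(** Congruences modulo [J] between corner elements are congruences modulo [I], which [X]
    contains. *)
Let eqI X x y : (I <= X)%VS -> x \in corner f -> y \in corner f -> x =J y ->
  y \in X -> x \in X.
Proof.
move=> IX cx cy xy Xy; rewrite -(subrK y x) rpredD //.
by apply: (subvP IX); rewrite memv_cap xy rpredB.
Qed.

(** With [ext_bicoef] this characterizes [ext_ideal X] inside [J'] by having all coefficients in
    [X]. Both conditions are linear, so the generators suffice, and those are handled by
    [bicoef_sandwich]. *)
Lemma bicoef_ext X i j z : ideal_of f X -> (I <= X)%VS ->
  z \in ext_ideal X -> bicoef i j z \in X.
Proof.
move=> Xid IX.
pose bL : {linear A -> A} :=
  HB.pack (bicoef i j) (GRing.isLinear.Build _ _ _ _ _ (bicoef_linear i j)).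
suff le : (ext_ideal X <= linfun bL @^-1: X)%VS.
  by move=> /(subvP le); rewrite -memv_preim lfunE.
have [cX _ _] := Xid.
rewrite subv_add; apply/andP; split.
  apply/subvP=> x Jx; rewrite -memv_preim lfunE /=; apply: (subvP IX).
  by rewrite memv_cap bicoef_corner bicoef_J.
apply/prodvP=> y b; have := @memvf _ _ b; move: b => b _.
move=> /mem_prodv_basisr[a _ ->] _; rewrite mulr_suml.
apply: rpred_sum => k _; set x := (vbasis X)`_k.
have Xx : x \in X by rewrite vbasis_mem // mem_nth // size_tuple.
rewrite -memv_preim lfunE /=; have cx := subvP cX _ Xx.
have Y : lcoef i (a k * f) * x * rcoef j (f * b) \in X.
  exact: ideal_absorb Xid (lcoef_corner _ _) Xx (rcoef_corner _ _).
apply: (eqI IX _ _ (bicoef_sandwich i j (a k) b cx) Y); first exact: bicoef_corner.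
exact: (subvP cX _ Y).
Qed.

Lemma ext_bicoef (X : {vspace A}) z : z \in J' ->
  (forall i j, bicoef i j z \in X) ->
  z \in ext_ideal X.
Proof.
move=> J'z zX; rewrite -(subrK (\sum_k \sum_l v k * bicoef k l z * u l) z).
apply: memv_add; first exact: bicoef_gen.
by do 2!apply: rpred_sum => ? _; rewrite !memv_mul ?memvf.
Qed.

Lemma ext_ideal_bounded X : (X <= corner f)%VS -> (ext_ideal X <= J')%VS.
Proof.
move=> cX; rewrite subv_add JJ' /=; apply/prodvP=> y b.
move=> /mem_prodv_basisr[a _ ->] _; rewrite mulr_suml.
apply: rpred_sum => k _; set x := (vbasis X)`_k.
have Xx : x \in X by rewrite vbasis_mem // mem_nth // size_tuple.
by have [fx _] := cornerE (subvP cX _ Xx); rewrite -mulrA J'Ml // J'Mr // fJ'l.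
Qed.

Lemma ideal2_ext X : ideal2 (ext_ideal X).
Proof.
move=> a x /memv_addP[y Jy [z Xz ->]].
have [Jay Jya] := Jid a Jy; have [Xaz Xza] := ideal2_gen a Xz.
by rewrite mulrDr mulrDl !memv_add.
Qed.

(** * Induced modules and the tensor product *)

Section Cells.
Variables (d : nat) (w : 'Hom(A, 'M[K]_d)).
Hypothesis wM :
  forall x y, x \in corner f -> y \in corner f -> w (x * y) = w x *m w y.
Hypothesis wI : forall x, x \in I -> w x = 0.

Lemma hom_congr x y : x \in corner f -> y \in corner f -> x =J y -> w x = w y.
Proof.
move=> cx cy xy; apply/eqP; rewrite -subr_eq0 -linearB; apply/eqP/wI.
by rewrite memv_cap xy rpredB.
Qed.

(** The matrix over fAf of left multiplication by [a] on the generators [v], pushed through the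
    representation; at 1 it is the block idempotent whose image realizes the induced module. *)
Definition lblock (k l : 'I_m) a : 'M[K]_d := w (lcoef k (a * v l)).
Definition rblock (k l : 'I_m') a : 'M[K]_d := w (rcoef l (u k * a)).

Lemma lcoef_mull_rep k x z : z \in J' ->
  w (lcoef k (x * z)) = \sum_l lblock k l x *m w (lcoef l z).
Proof.
move=> J'z; under eq_bigr do rewrite -wM ?lcoef_corner //.
rewrite -linear_sum; apply: hom_congr; rewrite ?lcoef_corner ?lcoef_mull //.
by apply: rpred_sum => l _; rewrite cornerM ?lcoef_corner.
Qed.

Lemma rcoef_mulr_rep k x z : z \in J' ->
  w (rcoef k (z * x)) = \sum_l w (rcoef l z) *m rblock l k x.
Proof.
move=> J'z; under eq_bigr do rewrite -wM ?rcoef_corner //.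
rewrite -linear_sum; apply: hom_congr; rewrite ?rcoef_corner ?rcoef_mulr //.
by apply: rpred_sum => l _; rewrite cornerM ?rcoef_corner.
Qed.

Lemma lblockM k l a b : \sum_j lblock k j a *m lblock j l b = lblock k l (a * b).
Proof. by rewrite /lblock -mulrA lcoef_mull_rep ?J'Ml. Qed.

Lemma rblockM k l a b : \sum_j rblock k j a *m rblock j l b = rblock k l (a * b).
Proof. by rewrite /rblock mulrA rcoef_mulr_rep ?J'Mr. Qed.

Lemma lblock_linear k l : linear (lblock k l).
Proof.
by move=> a x y; rewrite /lblock mulrDl -scalerAl lcoef_linear linearP.
Qed.

Lemma rblock_linear k l : linear (rblock k l).
Proof.
by move=> a x y; rewrite /rblock mulrDr -scalerAr rcoef_linear linearP.
Qed.

Variables (r : nat) (Q : 'I_m -> 'M[K]_(r, d)) (P : 'I_m -> 'M[K]_(d, r)).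
Hypothesis PQ : forall k l, P k *m Q l = lblock k l 1.

Lemma mul_P_Q_lcoef k z : z \in J' ->
  \sum_l P k *m (Q l *m w (lcoef l z)) = w (lcoef k z).
Proof.
move=> J'z; under eq_bigr do rewrite mulmxA PQ.
by rewrite -lcoef_mull_rep // mul1r.
Qed.

Definition tens_coef k (y : {ffun 'I_d -> A}) : 'cV[K]_d :=
  \sum_j w (lcoef k (y j)) *m delta_mx j 0.
Definition tens_map (y : {ffun 'I_d -> A}) : 'cV[K]_r :=
  \sum_k Q k *m tens_coef k y.

Lemma tens_coef_linear k : linear (tens_coef k).
Proof.
move=> a x y; rewrite /tens_coef scaler_sumr -big_split; apply: eq_bigr => j _.
by rewrite !ffunE lcoef_linear linearP mulmxDl -scalemxAl.
Qed.

Lemma tens_map_linear : linear tens_map.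
Proof.
move=> a x y; rewrite /tens_map scaler_sumr -big_split; apply: eq_bigr => j _.
by rewrite tens_coef_linear mulmxDr -scalemxAr.
Qed.

Lemma tens_coef_elt k x c : tens_coef k (tens_elt x c) = w (lcoef k x) *m c.
Proof.
rewrite /tens_coef [in RHS](matrix_sum_delta c) mulmx_sumr; apply: eq_bigr => j _.
rewrite big_ord1 ffunE -scalemxAr scalemxAl; congr (_ *m _).
have := lcoef_linear k (c j 0) x 0; rewrite !addr0 => ->.
by rewrite /lcoef linear0 mul0r addr0 linearZ.
Qed.

(** The coefficients of a tensor are recovered from its image, so the kernel of [tens_map] is the
    common kernel of the [tens_coef]. *)
Lemma mul_P_tens_map k (y : {ffun 'I_d -> A}) : (forall j, y j * f = y j) ->
  P k *m tens_map y = tens_coef k y.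
Proof.
move=> yf; rewrite /tens_map mulmx_sumr /tens_coef.
under eq_bigr do rewrite mulmx_sumr mulmx_sumr.
rewrite exchange_big; apply: eq_bigr => j _ /=.
under eq_bigr do rewrite !mulmxA -[_ *m _ *m w _]mulmxA.
by rewrite -mulmx_suml mul_P_Q_lcoef // J'f.
Qed.

End Cells.

Section TensRels.
Variable W0 : rep A.
Implicit Types (x : A) (y : {ffun 'I_(rdim W0) -> A}) (c : 'cV[K]_(rdim W0)).

Lemma in_tens_rels0 : in_tens_rels f W0 0.
Proof. by exists [::]; rewrite big_nil. Qed.

Lemma in_tens_relsD y1 y2 :
  in_tens_rels f W0 y1 -> in_tens_rels f W0 y2 -> in_tens_rels f W0 (y1 + y2).
Proof.
move=> [s1 [h1 ->]] [s2 [h2 ->]]; exists (s1 ++ s2); rewrite big_cat; split=> // z.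
by rewrite mem_cat => /orP[/h1|/h2].
Qed.

Lemma in_tens_rels_sum (T : finType) (F : T -> {ffun 'I_(rdim W0) -> A}) :
  (forall i, in_tens_rels f W0 (F i)) -> in_tens_rels f W0 (\sum_i F i).
Proof.
move=> hF; apply: big_ind => //; [exact: in_tens_rels0|exact: in_tens_relsD].
Qed.

Lemma in_tens_rels1 x b c : x \in lcorner f -> b \in corner f ->
  in_tens_rels f W0 (tens_elt (x * b) c - tens_elt x (ract W0 b *m c)).
Proof.
move=> fx cb; exists [:: (x, b, c)]; rewrite big_seq1; split=> // z.
by rewrite inE => /eqP ->.
Qed.

Lemma tens_eltDl x1 x2 c : tens_elt (x1 + x2) c = tens_elt x1 c + tens_elt x2 c.
Proof. by apply/ffunP=> j; rewrite !ffunE scalerDr. Qed.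

Lemma tens_elt_suml (T : finType) (F : T -> A) c :
  tens_elt (\sum_i F i) c = \sum_i tens_elt (F i) c.
Proof.
apply/ffunP=> j; rewrite ffunE sum_ffunE scaler_sumr.
by apply: eq_bigr => i _; rewrite ffunE.
Qed.

Lemma tens_elt_sumr (T : finType) (F : T -> 'cV[K]_(rdim W0)) x :
  tens_elt x (\sum_i F i) = \sum_i tens_elt x (F i).
Proof.
apply/ffunP=> j; rewrite ffunE sum_ffunE summxE scaler_suml.
by apply: eq_bigr => i _; rewrite ffunE.
Qed.

Lemma tens_elt0r x : tens_elt x 0 = 0 :> {ffun 'I_(rdim W0) -> A}.
Proof. by apply/ffunP=> j; rewrite !ffunE mxE scale0r. Qed.

Lemma tens_eltE y : y = \sum_j tens_elt (y j) (delta_mx j 0).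
Proof.
apply/ffunP=> j; rewrite sum_ffunE (bigD1 j) //= big1 ?addr0 => [|i ne].
  by rewrite ffunE mxE !eqxx scale1r.
by rewrite ffunE mxE eq_sym (negbTE ne) scale0r.
Qed.

End TensRels.

(** The dual basis controls tensors only modulo [J]. The inclusion assumed for [J :&: lcorner f]
    removes the ambiguity: such elements factor through [I], which kills [W0], so they vanish in the
    tensor product over fAf. *)
Lemma tensor_iso_blockrep (W0 : rep A) (w : 'Hom(A, 'M[K]_(rdim W0))) r
    (Q : 'I_m -> 'M[K]_(r, rdim W0)) (P : 'I_m -> 'M[K]_(rdim W0, r)) :
  is_rep f I W0 -> {in corner f, ract W0 =1 w} ->
  (J :&: lcorner f <= lcorner f * I)%VS ->
  \sum_k Q k *m P k = 1%:M -> (forall k l, P k *m Q l = lblock w k l 1) ->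
  tensor_iso f W0 (Rep (blockrep Q P (lblock w))).
Proof.
move=> [_ W0M W01 W0I] wE Jlcorner QP PQ.
have If x : x \in I -> x \in corner f by rewrite memv_cap => /andP[].
have wM x y : x \in corner f -> y \in corner f -> w (x * y) = w x *m w y.
  by move=> cx cy; rewrite -!wE ?W0M ?cornerM.
have wI x : x \in I -> w x = 0 by move=> Ix; rewrite -wE ?W0I ?If.
have lE x : (x \in lcorner f) = (x * f == x) by apply: mem_lcorner.
have T0 : tens_map w Q 0 = 0.
  have := tens_map_linear w Q (-1) 0 0.
  by rewrite !scaleN1r oppr0 addr0 addNr.
exists (tens_map w Q) => D; rewrite /D; split=> /=.
- by move=> a y1 y2 _ _; apply: tens_map_linear.
- move=> x y Dy.
  have yf j : y j * f = y j by apply/eqP; rewrite -lE.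
  rewrite /blockrep mulmx_suml; apply: eq_bigr => k _; rewrite mulmx_suml.
  under eq_bigr do rewrite -mulmxA (mul_P_tens_map wM wI PQ _ yf) -mulmxA.
  rewrite -mulmx_sumr; congr (_ *m _); rewrite /tens_coef.
  under [RHS]eq_bigr do rewrite mulmx_sumr.
  rewrite exchange_big; apply: eq_bigr => j _ /=; rewrite ffunE.
  rewrite lcoef_mull_rep ?J'f // mulmx_suml.
  by apply: eq_bigr => l _; rewrite mulmxA.
(* The preimage is the sum of the v_k tensor P_k c, because the [Q k *m P k] sum to the identity. *)
- move=> c; exists (\sum_k tens_elt (v k) (P k *m c)) => [j|].
    rewrite sum_ffunE rpred_sum // => k _; rewrite ffunE rpredZ //.
    by rewrite lE vf.
  rewrite -[RHS]mul1mx -QP mulmx_suml /tens_map; apply: eq_bigr => k _.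
  have -> : tens_coef w k (\sum_l tens_elt (v l) (P l *m c))
      = \sum_l tens_coef w k (tens_elt (v l) (P l *m c)).
    pose TL : {linear {ffun 'I_(rdim W0) -> A} -> 'cV[K]_(rdim W0)} :=
      HB.pack (tens_coef w k)
        (GRing.isLinear.Build _ _ _ _ _ (tens_coef_linear w k)).
    exact: (linear_sum TL).
  under eq_bigr do rewrite tens_coef_elt mulmxA.
  rewrite -mulmxA; congr (_ *m _); rewrite -mulmx_suml.
  suff -> : \sum_l w (lcoef k (v l)) *m P l = P k by [].
  rewrite -[RHS]mulmx1 -QP mulmx_sumr; apply: eq_bigr => l _.
  by rewrite mulmxA PQ /lblock mul1r.
- move=> y Dy; have yf j : y j * f = y j by apply/eqP; rewrite -lE.
  split=> [Ty0|[q [qD ->]]]; last first.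
    elim: q qD => [_|z q IH qD]; first by rewrite big_nil.
    rewrite big_cons -[tens_rel W0 z]scale1r tens_map_linear IH; last first.
      by move=> z' z'q; apply: qD; rewrite inE z'q orbT.
    have [lz cz] := qD z (mem_head _ _); rewrite scale1r addr0.
    rewrite /tens_rel addrC -scaleN1r tens_map_linear scaleN1r addrC.
    rewrite /tens_map -sumrB big1 // => k _.
    rewrite !tens_coef_elt -mulmxBr mulmxA wE //.
    rewrite -mulmxBl -wM ?lcoef_corner //.
    have J'z : z.1.1 \in J' by rewrite J'f //; apply/eqP; rewrite -lE.
    have Tc x : lcoef k x \in corner f := lcoef_corner k x.
    rewrite (hom_congr wI (Tc _) (cornerM (Tc _) cz) (lcoef_mulr k J'z cz)).
    by rewrite subrr mul0mx mulmx0.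
  have coef0 k : tens_coef w k y = 0.
    by rewrite -(mul_P_tens_map wM wI PQ k yf) Ty0 mulmx0.
  pose c j k := w (lcoef k (y j)) *m (delta_mx j 0 : 'cV[K]_(rdim W0)).
  pose res j := y j - \sum_k v k * lcoef k (y j).
  have resJ j : res j \in (J :&: lcorner f)%VS.
    rewrite memv_cap lcoef_gen //= rpredB ?Dy // rpred_sum // => k _.
    rewrite lE -mulrA.
    by have [_ ->] := cornerE (lcoef_corner k (y j)).
  (* The terms [tens_elt (v k) (tens_coef w k y)] are zero; subtracting them exhibits [y] as
     relations moving the corner coefficients across, plus a residue in [J] and Af. *)
  have -> : y = \sum_j (\sum_k (tens_elt (v k * lcoef k (y j)) (delta_mx j 0)
                                  - tens_elt (v k) (c j k))
                        + tens_elt (res j) (delta_mx j 0)).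
    transitivity (y - \sum_k tens_elt (v k) (tens_coef w k y)).
      by rewrite big1 ?subr0 // => k _; rewrite coef0 tens_elt0r.
    under [in LHS]eq_bigr do rewrite tens_elt_sumr.
    rewrite exchange_big {1}(tens_eltE y) -sumrB; apply: eq_bigr => j _ /=.
    rewrite sumrB addrAC; congr (_ - _).
    by rewrite -tens_elt_suml -tens_eltDl addrC subrK.
  apply: in_tens_rels_sum => j; apply: in_tens_relsD.
    apply: in_tens_rels_sum => k; rewrite /c -wE ?lcoef_corner //.
    by apply: in_tens_rels1; rewrite ?lcoef_corner // lE vf.
  have /mem_prodv_basisr[b bf ->] := subvP Jlcorner _ (resJ j).
  rewrite tens_elt_suml; apply: in_tens_rels_sum => k.
  have Ik : (vbasis I)`_(k : 'I_(\dim I)) \in I.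
    by rewrite vbasis_mem // mem_nth // size_tuple.
  rewrite -[tens_elt _ _]subr0 -(tens_elt0r W0 (b k)).
  have <- : ract W0 (vbasis I)`_k *m delta_mx j 0 = (0 : 'cV_(rdim W0)).
    by rewrite W0I // mul0mx.
  by apply: in_tens_rels1; rewrite ?If.
Qed.

(** Membership in each extended ideal is tested on coefficients, where the inclusion is assumed. *)
Lemma ext_ideal_cap X Z Y :
    ideal_of f X -> ideal_of f Z -> (I <= X)%VS -> (I <= Z)%VS ->
    (X :&: Z <= Y)%VS ->
  (ext_ideal X :&: ext_ideal Z <= ext_ideal Y)%VS.
Proof.
move=> Xid Zid IX IZ XZY; apply/subvP => z /memv_capP[Xz Zz].
have [cX _ _] := Xid; apply: ext_bicoef => [|i j].
  exact: (subvP (ext_ideal_bounded cX)).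
by apply: (subvP XZY); rewrite memv_cap !bicoef_ext.
Qed.

(** Applying [phi0] to the coefficient matrix gives a block matrix fixed by the block idempotents of
    [W0] and [W0'] on its two sides; [phi] is its compression to their images. *)
Lemma layer_cell (W0 W0' : rep A) (X Y : {vspace A})
    (phi0 : A -> 'M[K]_(rdim W0, rdim W0')) :
  is_rep f I W0 -> is_rep f I W0' ->
  (J :&: lcorner f <= lcorner f * I)%VS ->
  ideal_of f X -> ideal_of f Y -> (I <= Y)%VS -> (Y <= X)%VS ->
  linear_on (fun a (M : 'M[K]_(rdim W0, rdim W0')) => a *: M) X phi0 ->
  (forall M, exists2 x, x \in X & phi0 x = M) ->
  (forall x, x \in X -> (phi0 x = 0 <-> x \in Y)) ->
  (forall a b x, a \in corner f -> b \in corner f -> x \in X ->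
    phi0 (a * x * b) = ract W0 a *m phi0 x *m ract W0' b) ->
  exists (M M' : rep A) (phi : A -> 'M[K]_(rdim M, rdim M')),
  [/\ is_rep 1 0%VS M /\ is_rep 1 0%VS M',
      linear_on (fun a (N : 'M[K]_(rdim M, rdim M')) => a *: N) (ext_ideal X) phi,
      (forall N, exists2 x, x \in ext_ideal X & phi x = N),
      (forall x, x \in ext_ideal X -> (phi x = 0 <-> x \in ext_ideal Y)) &
      (forall a b x, x \in ext_ideal X ->
        phi (a * x * b) = ract M a *m phi x *m ract M' b)] /\
  tensor_iso f W0 M.
Proof.
move=> W_rep W'_rep Jlcorner Xid Yid IY YX phi0_lin phi0_surj phi0_ker phi0_mul.
have [cX _ _] := Xid; have IX := subv_trans IY YX.
have If x : x \in I -> x \in corner f by rewrite memv_cap => /andP[].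
have [W_lin WM W1 WI] := W_rep; have [W'_lin W'M W'1 W'I] := W'_rep.
have [w wE] := linear_on_ext W_lin; have [w' w'E] := linear_on_ext W'_lin.
have [H HE] := linear_on_ext phi0_lin.
have wM x y : x \in corner f -> y \in corner f -> w (x * y) = w x *m w y.
  by move=> cx cy; rewrite -!wE ?WM ?cornerM.
have wI x : x \in I -> w x = 0 by move=> Ix; rewrite -wE ?WI ?If.
have w'M x y : x \in corner f -> y \in corner f -> w' (x * y) = w' x *m w' y.
  by move=> cx cy; rewrite -!w'E ?W'M ?cornerM.
have w'I x : x \in I -> w' x = 0 by move=> Ix; rewrite -w'E ?W'I ?If.
have lblock0 k l x : x \in 0%VS -> lblock w k l x = 0.
  by rewrite memv0 => /eqP ->; rewrite /lblock mul0r /lcoef linear0 mul0r linear0.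
have rblock0 k l x : x \in 0%VS -> rblock w' k l x = 0.
  by rewrite memv0 => /eqP ->; rewrite /rblock mulr0 /rcoef linear0 mulr0 linear0.
have [r [Q [P [QP PQ Mrep]]]] := blockrep_exists (@mulr1 A) (@mul1r A)
  (lblockM wM wI) (lblock_linear w) lblock0.
have [r' [Q' [P' [QP' PQ' Mrep']]]] := blockrep_exists (@mulr1 A) (@mul1r A)
  (rblockM w'M w'I) (rblock_linear w') rblock0.
have algrep_is_rep n (rho : A -> 'M[K]_n) :
    algrep *%R 0%VS rho -> is_rep 1 0%VS (Rep rho).
  by case=> rL rM r1 r0; split=> [c x y _ _|x y _ _||] //=; rewrite ?rL ?rM.
pose phi z := \sum_k \sum_l Q k *m H (bicoef k l z) *m P' l.
have bX i j z : z \in ext_ideal X -> bicoef i j z \in X by apply: bicoef_ext.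
have H_congr x y : x \in X -> y \in X -> x =J y -> H x = H y.
  move=> Xx Xy xy; apply/eqP; rewrite -subr_eq0; apply/eqP.
  transitivity (H (x - y)); first by rewrite linearB.
  have Ixy : x - y \in I by rewrite memv_cap xy rpredB // (subvP cX).
  by rewrite -HE ?(subvP IX) // (phi0_ker _ _).2 ?(subvP IX) ?(subvP IY).
have H_mul a b x : a \in corner f -> b \in corner f -> x \in X ->
    H (a * x * b) = w a *m H x *m w' b.
  move=> ca cb Xx; rewrite -!HE ?phi0_mul ?wE ?w'E //.
  exact: ideal_absorb Xid ca Xx cb.
have H_bicoef i j a z b : z \in ext_ideal X -> H (bicoef i j (a * z * b))
    = \sum_k \sum_l lblock w i k a *m H (bicoef k l z) *m rblock w' l j b.
  move=> Xz; have J'z := subvP (ext_ideal_bounded cX) _ Xz.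
  have Xazb : a * z * b \in ext_ideal X.
    by have [az _] := ideal2_ext a Xz; have [_] := ideal2_ext b az.
  rewrite (H_congr _ _ _ _ (bicoef_mul i j a b J'z)) ?bX //; last first.
    do 2!apply: rpred_sum => ? _.
    by apply: ideal_absorb Xid _ _ _; rewrite ?lcoef_corner ?rcoef_corner ?bX.
  rewrite linear_sum; apply: eq_bigr => k _; rewrite linear_sum.
  by apply: eq_bigr => l _ /=; rewrite H_mul ?lcoef_corner ?rcoef_corner ?bX.
(* Decompression: the blocks are recovered from [phi z], which reduces the kernel of [phi] to that
   of [phi0]. *)
have PphiQ i j z : z \in ext_ideal X -> P i *m phi z *m Q' j = H (bicoef i j z).
  move=> Xz; rewrite -[z in RHS]mul1r -[1 * z]mulr1 H_bicoef //.
  rewrite mulmx_sumr mulmx_suml; apply: eq_bigr => k _.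
  rewrite mulmx_sumr mulmx_suml; apply: eq_bigr => l _.
  by rewrite -PQ -PQ' !mulmxA.
exists (Rep (blockrep Q P (lblock w))), (Rep (blockrep Q' P' (rblock w'))), phi.
split; last by apply: tensor_iso_blockrep.
split=> [||N|x Xx|a b x Xx] /=.
- by split; apply: algrep_is_rep.
- move=> c x y _ _; rewrite /phi scaler_sumr -big_split; apply: eq_bigr => k _ /=.
  rewrite scaler_sumr -big_split; apply: eq_bigr => l _ /=.
  by rewrite bicoef_linear linearP mulmxDr mulmxDl -scalemxAr -scalemxAl.
(* To reach [N], lift each block [P k *m N *m Q' l] to some [x (k, l)] in [X] and take the sum of
   the [v k * x (k, l) * u l]. *)
- have /fin_all_exists2[x Xx xE] (kl : 'I_m * 'I_m') :
      exists2 x, x \in X & H x = P kl.1 *m N *m Q' kl.2.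
    have [x Xx xE] := phi0_surj (P kl.1 *m N *m Q' kl.2).
    by exists x; rewrite -?HE.
  exists (\sum_k \sum_l v k * x (k, l) * u l).
    do 2!apply: rpred_sum => ? _; apply: (subvP (addvSr _ _)).
    by rewrite !memv_mul ?memvf.
  have HN i j : H (bicoef i j (\sum_k \sum_l v k * x (k, l) * u l))
      = P i *m N *m Q' j.
    pose bL : {linear A -> A} :=
      HB.pack (bicoef i j) (GRing.isLinear.Build _ _ _ _ _ (bicoef_linear i j)).
    rewrite -[bicoef i j _]/(bL _) !linear_sum.
    transitivity (\sum_k \sum_l P i *m (Q k *m P k) *m N *m (Q' l *m P' l) *m Q' j).
      apply: eq_bigr => k _; rewrite !linear_sum; apply: eq_bigr => l _ /=.
      have Xv : bicoef i j (v k * x (k, l) * u l) \in X.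
        by apply/bX/(subvP (addvSr _ _)); rewrite !memv_mul ?memvf.
      have e := bicoef_sandwich i j (v k) (u l) (subvP cX _ (Xx (k, l))).
      rewrite (H_congr _ _ Xv _ e); last first.
        by apply: ideal_absorb Xid _ _ _; rewrite ?lcoef_corner ?rcoef_corner.
      rewrite H_mul ?lcoef_corner ?rcoef_corner // xE vf fu.
      have := PQ i k; rewrite /lblock mul1r => <-.
      by have := PQ' l j; rewrite /rblock mulr1 => <-; rewrite !mulmxA.
    under eq_bigr do rewrite -mulmx_suml -mulmx_sumr QP' mulmx1.
    by rewrite -!mulmx_suml -mulmx_sumr QP mulmx1.
  rewrite -[RHS]mulmx1 -QP' -[N in RHS]mul1mx -QP !mulmx_suml.
  apply: eq_bigr => k _; rewrite mulmx_sumr; apply: eq_bigr => l _.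
  by rewrite HN !mulmxA.
- split=> [phix0|Yx].
    have J'x := subvP (ext_ideal_bounded cX) _ Xx.
    apply: ext_bicoef => // i j; apply/(phi0_ker _ (bX i j _ Xx)).
    by rewrite HE ?bX // -PphiQ // phix0 mulmx0 mul0mx.
  rewrite /phi big1 // => k _; rewrite big1 // => l _.
  rewrite -HE ?bX // (phi0_ker _ _).2 ?bX ?mulmx0 ?mul0mx //.
  exact: bicoef_ext.
- have bP' l c : P' l *m blockrep Q' P' (rblock w') c
      = \sum_j rblock w' l j c *m P' j.
    exact: (mul_P_blockrep (@mul1r A) (rblockM w'M w'I) PQ').
  have bQ k c : blockrep Q P (lblock w) c *m Q k = \sum_i Q i *m lblock w i k c.
    exact: (mul_blockrep_Q (@mulr1 A) (lblockM wM wI) PQ).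
  transitivity (\sum_k \sum_l \sum_i \sum_j
    Q i *m lblock w i k a *m H (bicoef k l x) *m rblock w' l j b *m P' j).
    transitivity (\sum_i \sum_j \sum_k \sum_l
      Q i *m lblock w i k a *m H (bicoef k l x) *m rblock w' l j b *m P' j).
      apply: eq_bigr => i _; apply: eq_bigr => j _.
      rewrite H_bicoef // mulmx_sumr mulmx_suml; apply: eq_bigr => k _.
      by rewrite mulmx_sumr mulmx_suml; apply: eq_bigr => l _; rewrite !mulmxA.
    under eq_bigr do rewrite exchange_big /=.
    rewrite exchange_big; apply: eq_bigr => k _ /=.
    under eq_bigr do rewrite exchange_big /=.
    by rewrite exchange_big.
  rewrite /phi [X in _ = X *m _]mulmx_sumr mulmx_suml; apply: eq_bigr => k _.
  rewrite [X in _ = X *m _]mulmx_sumr mulmx_suml; apply: eq_bigr => l _.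
  rewrite 2!mulmxA bQ -mulmxA bP' !mulmx_suml; apply: eq_bigr => i _.
  by rewrite mulmx_sumr; apply: eq_bigr => j _; rewrite !mulmxA.
Qed.

End Layer.

(** * Posets and standardly based structures *)

(** Induction on the number of elements strictly above [p]. *)
Lemma poset_up_ind (T : finType) (le : rel T) (P : T -> Prop) : is_poset le ->
  (forall p, (forall q, strict le p q -> P q) -> P p) -> forall p, P p.
Proof.
case=> le_refl le_anti le_trans IH p.
have [k] := ubnP #|[pred q | strict le p q]|.
elim: k p => // k IHk p; rewrite ltnS => lek; apply: IH => q /andP[pq npq].
apply: IHk; apply: leq_trans lek; apply: proper_card; apply/properP; split.
  apply/subsetP=> r; rewrite !inE => /andP[qr nqr].
  rewrite /strict (le_trans _ _ _ pq qr); apply: contra npq => /eqP pr.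
  by rewrite eq_sym; apply/eqP/le_anti; rewrite pq pr qr.
by exists q; rewrite inE /strict ?pq ?npq // eqxx andbF.
Qed.

Lemma poset_down_ind (T : finType) (le : rel T) (P : T -> Prop) : is_poset le ->
  (forall p, (forall q, strict le q p -> P q) -> P p) -> forall p, P p.
Proof.
case=> le_refl le_anti le_trans IH; apply: (@poset_up_ind T (fun p q => le q p)).
  split=> // [x y /andP[yx xy]|y x z yx zy].
    by apply: le_anti; rewrite xy.
  exact: le_trans zy yx.
move=> p IHp; apply: IH => q /andP[qp nqp].
by apply: IHp; rewrite /strict qp eq_sym.
Qed.

Section IdealOf.
Variables (K : fieldType) (A : falgType K) (e : A).
Implicit Types (X Y J : {vspace A}).

Lemma ideal_ofD X Y : ideal_of e X -> ideal_of e Y -> ideal_of e (X + Y)%VS.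
Proof.
move=> [cX lX rX] [cY lY rY]; split; first by rewrite subv_add cX.
  by rewrite prodvDr addvS.
by rewrite prodvDl addvS.
Qed.

Lemma ideal_of_sum (T : finType) (P : pred T) (F : T -> {vspace A}) :
  (forall q, P q -> ideal_of e (F q)) -> ideal_of e (\sum_(q | P q) F q)%VS.
Proof.
move=> hF; apply: big_ind => //; last exact: ideal_ofD.
by split; rewrite ?prodv0 ?prod0v ?sub0v.
Qed.

Lemma ideal_of_cap J : e * e = e -> ideal2 J -> ideal_of e (corner e :&: J)%VS.
Proof.
move=> ee Jid.
have cornerM x y := @corner_mul K A e x y ee.
split; first exact: capvSl.
  apply/prodvP=> x y cx /memv_capP[cy Jy]; rewrite memv_cap cornerM //=.
  by case: (Jid x y Jy).
apply/prodvP=> y x /memv_capP[cy Jy] cx; rewrite memv_cap cornerM //=.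
by case: (Jid x y Jy).
Qed.

End IdealOf.

Section ExtIdeal.
Variables (K : fieldType) (A : falgType K) (J : {vspace A}).
Implicit Types X Y : {vspace A}.

Lemma ext_idealD X Y : ext_ideal J (X + Y) = (ext_ideal J X + ext_ideal J Y)%VS.
Proof.
rewrite /ext_ideal prodvDr prodvDl -{1}(addvv J) -!addvA.
by congr (_ + _)%VS; rewrite !addvA (addvC J).
Qed.

Lemma ext_idealS X Y : (X <= Y)%VS -> (ext_ideal J X <= ext_ideal J Y)%VS.
Proof. by move=> XY; rewrite addvS ?prodvSl ?prodvSr. Qed.

Lemma ext_ideal_id X : ideal2 J -> (X <= J)%VS -> ext_ideal J X = J.
Proof.
move=> Jid XJ; apply/addv_idPl/prodvP=> x b.
have le : (fullv * X <= J)%VS.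
  by apply/prodvP=> a y _ /(subvP XJ)/(Jid a)[].
by move=> /(subvP le) /(Jid b)[].
Qed.

Lemma ext_ideal_sum (T : finType) (P : pred T) (F : T -> {vspace A}) Z :
  (J <= Z)%VS -> (forall q, P q -> (ext_ideal J (F q) <= Z)%VS) ->
  (ext_ideal J (\sum_(q | P q) F q) <= Z)%VS.
Proof.
move=> JZ hF.
apply: (big_ind (fun X => (ext_ideal J X <= Z)%VS)) => [|X Y hX hY|] //.
  by rewrite /ext_ideal prodv0 prod0v addv0.
by rewrite ext_idealD subv_add hX.
Qed.

End ExtIdeal.

Section StandardlyBased.
Variables (K : fieldType) (A : falgType K) (e : A) (I : {vspace A}).
Variables (T : finType) (le : rel T) (S : sb_struct A T).
Hypothesis S_sb : is_sb e I le S.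

(** Intersecting with this ideal expresses independence of the layers without naming complements, a
    form that can be transported to [A]. *)
Definition sb_nle p : {vspace A} := (I + \sum_(q | ~~ le q p) sb_ideal S q)%VS.

Lemma sb_cover : (corner e <= I + \sum_p sb_ideal S p)%VS.
Proof.
have [_ _ _ [C [CS _ _ _ <-]] _] := S_sb.
apply: addvS => //; apply/subv_sumP=> p _; exact: (sumv_sup p).
Qed.

(** Each ideal of index q lies in [I] plus the [C r] with r above q. Hence the ideals with q not
    below p involve no [C p], and directness kills the [C p] component of the intersection. *)
Lemma sb_ideal_capS p : (sb_ideal S p :&: sb_nle p <= sb_gt le I S p)%VS.
Proof.
have [le_po _ _ [C [CS Cgt _ Cdir _]] _] := S_sb.
have [le_refl le_anti le_trans] := le_po.
pose R := (I + \sum_(r | ~~ le r p) C r)%VS.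
have span : forall q, (sb_ideal S q <= I + \sum_(r | le q r) C r)%VS.
  apply: (poset_up_ind le_po) => q IH; rewrite -Cgt subv_add; apply/andP; split.
    by apply: subv_trans (addvSr _ _); apply: (sumv_sup q).
  rewrite subv_add addvSl; apply/subv_sumP=> r /[dup] qr /andP[leqr _].
  apply: subv_trans (IH r qr) _; apply: addvS => //; apply/subv_sumP=> r' rr'.
  by apply: (sumv_sup r') => //; apply: le_trans rr'.
have spanR q : ~~ le q p -> (sb_ideal S q <= R)%VS.
  move=> nqp; apply: subv_trans (span q) _; apply: addvS => //.
  apply/subv_sumP=> r qr; apply: (sumv_sup r) => //.
  by apply: contra nqp; apply: le_trans.
have nleR : (sb_nle p <= R)%VS.
  by rewrite subv_add addvSl; apply/subv_sumP.
have gtR : (sb_gt le I S p <= R)%VS.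
  rewrite subv_add addvSl; apply/subv_sumP=> q /andP[pq npq]; apply: spanR.
  by apply: contra npq => qp; apply/eqP/le_anti; rewrite pq.
apply/subvP=> x /memv_capP[]; rewrite -Cgt => /memv_addP[c Cc [g Gg ->]] nx.
have: c \in R.
  by rewrite -(addrK g c) rpredB //; [exact: (subvP nleR)|exact: (subvP gtR)].
case/memv_addP=> i Ii [d Dd cE].
move: Cdir; rewrite directv_addE /= => /and3P[_ /directv_sumP dC /eqP cap0].
have d0 : c - d = 0.
  apply/eqP; rewrite -memv0 -cap0 memv_cap; apply/andP; split.
    by rewrite cE addrK.
  rewrite rpredB //; first exact: (subvP (sumv_sup p (isT : xpredT p) (subvv _))).
  by move: d Dd {cE}; apply/subvP/subv_sumP=> r _; apply: (sumv_sup r).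
have c0 : c = 0.
  apply/eqP; rewrite -memv0 -(dC p isT) memv_cap Cc /=.
  have -> : c = d by apply/eqP; rewrite -subr_eq0 d0.
  move: d Dd {cE d0}; apply/subvP/subv_sumP=> r nrp; apply: (sumv_sup r) => //.
  by apply: contra nrp => /eqP ->.
by rewrite c0 add0r.
Qed.

End StandardlyBased.

Section BuildStandardlyBased.
Variables (K : fieldType) (A : falgType K) (T : finType) (le : rel T).
Variable S : sb_struct A T.
Hypothesis le_po : is_poset le.
Let gt p := (\sum_(q | strict le p q) sb_ideal S q)%VS.
Hypothesis cover : (fullv <= \sum_p sb_ideal S p)%VS.
Hypothesis mono : forall p q, strict le p q -> (sb_ideal S q <= sb_ideal S p)%VS.
Hypothesis cap : forall p,
  (sb_ideal S p :&: \sum_(q | ~~ le q p) sb_ideal S q <= gt p)%VS.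

(** Converse of [sb_ideal_capS]: any complements of the strict parts work. In a vanishing sum, once
    the terms below p are zero, the term at p lies in the ideals of index not below p, hence in
    [gt p], hence is zero. Upward induction gives the spanning. *)
Lemma sb_complements : exists C : T -> {vspace A},
  [/\ forall p, (C p <= sb_ideal S p)%VS,
      forall p, (C p + sb_gt le 0%VS S p)%VS = sb_ideal S p,
      forall p, (C p :&: sb_gt le 0%VS S p)%VS = 0%VS,
      directv (0 + \sum_(p : T) C p)%VS &
      (0 + \sum_(p : T) C p)%VS = corner (1 : A)].
Proof.
have gtE p : sb_gt le 0%VS S p = gt p by rewrite /sb_gt add0v.
have gt_sub p : (gt p <= sb_ideal S p)%VS.
  by apply/subv_sumP=> q; apply: mono.
pose C p := (sb_ideal S p :\: gt p)%VS.
have Cgt p : (C p + gt p)%VS = sb_ideal S p.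
  by rewrite -[RHS](addv_diff_cap _ (gt p)) (capv_idPr (gt_sub p)).
have Ccap p : (C p :&: gt p)%VS = 0%VS by apply: capv_diff.
have CS p : (C p <= sb_ideal S p)%VS by apply: diffvSl.
exists C; split=> // [p|p||]; rewrite ?gtE //.
- rewrite directv_addE /= directv_trivial /= cap0v eqxx andbT.
  apply/directv_sum_independent => c Cc c0 p _; move: p.
  apply: (poset_down_ind le_po) => p IH.
  apply/eqP; rewrite -memv0 -(Ccap p) memv_cap Cc //=; apply: (subvP (cap p)).
  rewrite memv_cap (subvP (CS p)) ?Cc //=.
  have -> : c p = - \sum_(q | q != p) c q.
    by move: c0; rewrite (bigD1 p) //= => /eqP; rewrite addr_eq0 => /eqP.
  rewrite rpredN; apply: rpred_sum => q nqp.
  have [qp|nq] := boolP (le q p); first by rewrite IH ?mem0v // /strict qp.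
  apply: (subvP (sumv_sup q nq (subvv _))); exact/(subvP (CS q))/Cc.
- rewrite add0v corner1; apply/eqP; rewrite eqEsubv subvf /=.
  apply: subv_trans cover _; apply/subv_sumP=> p _; move: p.
  apply: (poset_up_ind le_po) => p IH.
  rewrite -Cgt subv_add (sumv_sup p) //=; exact/subv_sumP.
Qed.

End BuildStandardlyBased.

(** * Assembling the layers *)

(** The type of the map depends on both modules; bundling them lets one choice over the finite index
    set select all cells together. *)
Record cell_data (K : fieldType) (A : falgType K) := CellData {
  cell_l : rep A;
  cell_r : rep A;
  cell_map : A -> 'M[K]_(rdim cell_l, rdim cell_r) }.

Definition is_cell (K : fieldType) (A : falgType K) (f : A) (W0 : rep A)
    (X Y : {vspace A}) (c : cell_data A) :=
  [/\ is_rep 1 0%VS (cell_l c) /\ is_rep 1 0%VS (cell_r c),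
      linear_on (fun a (N : 'M[K]_(rdim (cell_l c), rdim (cell_r c))) => a *: N)
        X (cell_map c),
      (forall N, exists2 x, x \in X & cell_map c x = N),
      (forall x, x \in X -> (cell_map c x = 0 <-> x \in Y)) &
      (forall a b x, x \in X -> cell_map c (a * x * b)
        = ract (cell_l c) a *m cell_map c x *m ract (cell_r c) b)] /\
  tensor_iso f W0 (cell_l c).

Section ProjectiveLayer.
Variables (K : fieldType) (A : falgType K) (f : A) (J : {vspace A}).
Hypotheses (ff : f * f = f) (Jid : ideal2 J).
Let J' := (fullv * <[f]> * fullv)%VS.
Let I := (corner f :&: J)%VS.
Hypothesis JJ' : (J <= J')%VS.
Hypothesis J_lproj : lproj_subquot 1 J J' J.
Hypothesis J_rproj : rproj_subquot 1 J J' J.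
Variables (T : finType) (le : rel T) (S : sb_struct A T).
Hypothesis S_sb : is_sb f I le S.

Let id_sum (P : pred T) : ideal_of f (I + \sum_(q | P q) sb_ideal S q)%VS.
Proof.
have [_ Sid _ _ _] := S_sb.
apply: ideal_ofD; first exact: ideal_of_cap.
by apply: ideal_of_sum => q _; case: (Sid q).
Qed.

Lemma projective_layer_cap p :
  (ext_ideal J (sb_ideal S p) :&: ext_ideal J (sb_nle I le S p)
    <= ext_ideal J (sb_gt le I S p))%VS.
Proof.
have [m [v [t [vf t1 t2 t3 t4]]]] := right_dual_basis ff Jid JJ' J_rproj.
have [m' [u [s [fu s1 s2 s3 s4]]]] := left_dual_basis ff Jid JJ' J_lproj.
have [_ Sid _ _ _] := S_sb; have [Xid IX] := Sid p.
by apply: (ext_ideal_cap ff Jid JJ' t1 t2 t3 t4 fu s1 s2 s3 s4 Xid (id_sum _) IX);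
  rewrite ?addvSl ?(sb_ideal_capS S_sb).
Qed.

Lemma projective_layer_cell p : (J :&: lcorner f <= lcorner f * I)%VS ->
  exists c, is_cell f (sb_W S p) (ext_ideal J (sb_ideal S p))
    (ext_ideal J (sb_gt le I S p)) c.
Proof.
move=> Jlcorner.
have [m [v [t [vf t1 t2 t3 t4]]]] := right_dual_basis ff Jid JJ' J_rproj.
have [m' [u [s [fu s1 s2 s3 s4]]]] := left_dual_basis ff Jid JJ' J_lproj.
have [_ Sid Smono _ Scell] := S_sb; have [Xid IX] := Sid p.
have [[Wrep W'rep] phi_lin phi_surj phi_ker phi_mul] := Scell p.
have YX : (sb_gt le I S p <= sb_ideal S p)%VS.
  by rewrite subv_add IX; apply/subv_sumP => q /Smono.
have [M [M' [phi h]]] := layer_cell ff Jid JJ' vf t1 t2 t3 t4 fu s1 s2 s3 s4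
  Wrep W'rep Jlcorner Xid (id_sum _) (addvSl _ _) YX
  phi_lin phi_surj phi_ker phi_mul.
by exists (CellData phi).
Qed.

End ProjectiveLayer.

(** * The chain of ideals and the order on the disjoint union *)

Section IdealChain.
Variables (K : fieldType) (A : falgType K) (Lam : finType) (n : nat).
Variables (eid : Lam -> A) (lev : Lam -> 'I_n.+1).

Lemma Jideal0 : Jideal eid lev 0 = 0%VS.
Proof.
rewrite /Jideal /gen_ideal; have -> : [seq l <- enum Lam | (lev l < 0)%N] = [::].
  by elim: (enum Lam).
by rewrite span_nil prodv0 prod0v.
Qed.

Lemma ideal2_Jideal i : ideal2 (Jideal eid lev i).
Proof. exact: ideal2_gen. Qed.

Lemma JidealS i j : (i <= j)%N -> (Jideal eid lev i <= Jideal eid lev j)%VS.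
Proof.
move=> ij; rewrite prodvSl // prodvSr //; apply: sub_span => x /mapP[l].
rewrite mem_filter => /andP[li lam] ->; apply/map_f.
by rewrite mem_filter lam andbT (leq_trans li).
Qed.

End IdealChain.

Lemma union_le_poset n (Lp : 'I_n.+1 -> finType) (le : forall i, rel (Lp i)) :
  (forall i, is_poset (le i)) -> is_poset (union_le le).
Proof.
move=> le_po; split.
- move=> [i p]; rewrite /union_le /= eqxx tagged_asE.
  by have [-> _ _] := le_po i; rewrite orbT.
- move=> [i p] [j q]; rewrite /union_le /= => /andP[].
  case/orP=> [ji|/andP[/eqP ij]].
    case/orP=> [/(ltn_trans ji)|/andP[/eqP e _]]; first by rewrite ltnn.
    by rewrite e ltnn in ji.
  subst j; rewrite tagged_asE ltnn eqxx tagged_asE /= => pq qp.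
  by have [_ anti _] := le_po i; rewrite (anti p q) ?pq.
- move=> [j q] [i p] [k r]; rewrite /union_le /=.
  case/orP=> [ji|/andP[/eqP ij]].
    case/orP=> [kj|/andP[/eqP jk _]]; first by rewrite (ltn_trans kj ji).
    by apply/orP; left; rewrite -jk.
  subst j; rewrite tagged_asE => pq /orP[->//|/andP[/eqP ik]].
  subst k; rewrite tagged_asE => qr; rewrite ltnn eqxx tagged_asE /=.
  by have [_ _ trans] := le_po i; apply: trans qr.
Qed.

Section IdempotentChain.
Variables (K : fieldType) (A : falgType K) (f g : A).
Hypotheses (ff : f * f = f) (gg : g * g = g) (gf : g * f = g) (fg : f * g = g).

(** In a product vgb with v in Ag, the idempotent is doubled: vg lies in Af because [g * f = g], and
    gbf lies in the corner because [f * g = g]. This supplies the hypothesis on [J :&: lcorner f]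
    for consecutive idempotents. *)
Lemma lower_ideal_lcorner (J := (fullv * <[g]> * fullv)%VS) :
  (J :&: lcorner f <= lcorner f * (corner f :&: J))%VS.
Proof.
apply/subvP=> z /memv_capP[]; rewrite mem_lcorner // => /mem_prodv_basisl[b _ ->].
move=> /eqP <-; rewrite mulr_suml; apply: rpred_sum => k _.
set v := (vbasis _)`_k; have gv : v \in lcorner g.
  by rewrite vbasis_mem // mem_nth // size_tuple.
move: gv; rewrite mem_lcorner // => /eqP <-.
have -> : v * g * b k * f = v * g * (g * b k * f).
  by rewrite !mulrA -(mulrA v g g) gg.
apply: memv_mul; first by rewrite mem_lcorner // -mulrA gf.
rewrite memv_cap mem_corner // !mulrA fg -[g * b k * f * f]mulrA ff eqxx /=.
by rewrite -mulrA -[g]mul1r !memv_mul ?memvf ?memv_line.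
Qed.

End IdempotentChain.

Section UnionLe.
Variables (n : nat) (Lp : 'I_n.+1 -> finType) (le : forall i, rel (Lp i)).
Implicit Types i : 'I_n.+1.

Lemma union_le_low (x y : {i & Lp i}) : (tag y < tag x)%N ->
  strict (union_le le) x y.
Proof.
move=> yx; rewrite /strict /union_le yx /=.
by apply: contraTneq yx => ->; rewrite ltnn.
Qed.

Lemma union_le_same i (p q : Lp i) :
  union_le le (@existT _ _ i p) (@existT _ _ i q) = @le i p q.
Proof. by rewrite /union_le /= ltnn eqxx tagged_asE. Qed.

Lemma strict_union_le_same i (p q : Lp i) :
  strict (union_le le) (@existT _ _ i p) (@existT _ _ i q) = strict (@le i) p q.
Proof. by rewrite /strict union_le_same eq_Tagged. Qed.

End UnionLe.

Unset Implicit Arguments.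
Set Strict Implicit.
Set Printing Implicit Defensive.

Theorem theorem5p7
  (K : fieldType) (A : falgType K)
  (* simple modules L(l), l in Lambda, and the primitive idempotents e_l *)
  (Lam : finType) (Lsimp : Lam -> rep A) (eid : Lam -> A)
  (hLrep : forall l, is_rep 1 0%VS (Lsimp l))
  (hLsimple : forall l, simple_rep (Lsimp l))
  (hLdistinct : forall l m, rep_iso (Lsimp l) (Lsimp m) -> l = m)
  (hLall : forall M : rep A, is_rep 1 0%VS M -> simple_rep M ->
             exists l, rep_iso M (Lsimp l))
  (heprim : forall l, primitive_idempotent (eid l))
  (hecorr : forall l m, ract (Lsimp m) (eid l) != 0 <-> l = m)
  (* the n-decomposition Lambda = Lambda_0 u ... u Lambda_n  (lev l = i iff l in Lambda_i) *)
  (n : nat) (lev : Lam -> 'I_n.+1)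
  (* the chosen idempotents f_1, ..., f_{n+1} with J_i = A f_i A *)
  (f : nat -> A)
  (hfidem : forall i, (1 <= i <= n.+1)%N -> f i * f i = f i)
  (hfJ : forall i, (1 <= i <= n.+1)%N -> Jideal eid lev i = (fullv * <[f i]> * fullv)%VS)
  (hfcomp : forall i j, (1 <= i)%N -> (i <= j)%N -> (j <= n.+1)%N ->
              f i * f j = f i /\ f j * f i = f i)
  (hfn : f n.+1 = 1)
  (* base stratified: J_{i+1}/J_i is projective as a left and as a right A/J_i-module *)
  (hprojl : forall i : 'I_n.+1,
     lproj_subquot 1 (Jideal eid lev i) (Jideal eid lev i.+1) (Jideal eid lev i))
  (hprojr : forall i : 'I_n.+1,
     rproj_subquot 1 (Jideal eid lev i) (Jideal eid lev i.+1) (Jideal eid lev i))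
  (* ... and A^(i) = f_{i+1} (A/J_i) f_{i+1} = f_{i+1}Af_{i+1} / f_{i+1}J_if_{i+1}
     carries the standardly based structure S i with poset (L_i, le i),
     cell modules W^0_i(p) = sb_W (S i) p *)
  (Lp : 'I_n.+1 -> finType) (le : forall i, rel (Lp i))
  (S : forall i : 'I_n.+1, sb_struct A (Lp i))
  (hS : forall i : 'I_n.+1,
     is_sb (f i.+1) (corner (f i.+1) :&: Jideal eid lev i)%VS (le i) (S i)) :
  (* A is standardly based for L = disjoint union of the L_i, with cell modules
     W(i,p) ~= A f_{i+1} (x)_{f_{i+1}Af_{i+1}} W^0_i(p) *)
  exists S0 : sb_struct A {i : 'I_n.+1 & Lp i},
    is_sb 1 0%VS (union_le le) S0 /\
    forall x : {i : 'I_n.+1 & Lp i},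
      tensor_iso (f (tag x).+1) (sb_W (S (tag x)) (tagged x)) (sb_W S0 x).
Proof.
pose J i := Jideal eid lev i.
have Jid i : ideal2 (J i) by apply: ideal2_Jideal.
have f_dom (i : 'I_n.+1) : (1 <= i.+1 <= n.+1)%N by rewrite /= ltn_ord.
have ff (i : 'I_n.+1) : f i.+1 * f i.+1 = f i.+1 by apply: hfidem.
have JE (i : 'I_n.+1) : J i.+1 = (fullv * <[f i.+1]> * fullv)%VS.
  exact: hfJ.
have JJ' (i : 'I_n.+1) : (J i <= fullv * <[f i.+1]> * fullv)%VS.
  by rewrite -JE; apply: JidealS.
have Jlc (i : 'I_n.+1) : (J i :&: lcorner (f i.+1)
    <= lcorner (f i.+1) * (corner (f i.+1) :&: J i))%VS.
  (* Nothing is assumed about [f 0], so level 0 is treated through J_0 = 0. *)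
  have [i0|i0] := posnP i; first by rewrite i0 [J 0]Jideal0 cap0v sub0v.
  have [gf fg] := hfcomp i i.+1 i0 (leqnSn _) (ltn_ord i).
  have i_dom : (1 <= i <= n.+1)%N by rewrite i0 ltnW.
  rewrite [J i](hfJ _ i_dom); apply: lower_ideal_lcorner => //.
  exact: hfidem.
have lproj (i : 'I_n.+1) :
    lproj_subquot 1 (J i) (fullv * <[f i.+1]> * fullv)%VS (J i).
  by rewrite -JE; apply: hprojl.
have rproj (i : 'I_n.+1) :
    rproj_subquot 1 (J i) (fullv * <[f i.+1]> * fullv)%VS (J i).
  by rewrite -JE; apply: hprojr.
pose I (i : 'I_n.+1) := (corner (f i.+1) :&: J i)%VS.
pose Id (x : {i & Lp i}) := ext_ideal (J (tag x)) (sb_ideal (S (tag x)) (tagged x)).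
pose Gt (x : {i & Lp i}) :=
  ext_ideal (J (tag x)) (sb_gt (le (tag x)) (I (tag x)) (S (tag x)) (tagged x)).
have /fin_all_exists[c cP] (x : {i & Lp i}) :
    exists c, is_cell (f (tag x).+1) (sb_W (S (tag x)) (tagged x)) (Id x) (Gt x) c.
  exact: (projective_layer_cell (ff _) (Jid _) (JJ' _) (lproj _) (rproj _) (hS _)).
pose S0 := SB Id (fun x => cell_map (c x)).
have le_po i : is_poset (le i) by case: (hS i).
have leU_po := union_le_poset le_po.
have J_sub i (x : {i & Lp i}) : (tag x < i)%N -> (Id x <= J i)%VS.
  case: x => j p /= ji; apply: subv_trans (JidealS eid lev ji); rewrite -/(J _) JE.
  apply: (ext_ideal_bounded (ff j) (JJ' j)).
  by have [_ Sid _ _ _] := hS j; have [[]] := Sid p.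
have ext0 (i : 'I_n.+1) : ext_ideal (J i) (I i) = J i.
  by apply: ext_ideal_id => //; apply: capvSr.
(* The levels below i fill J_i: at each stage the idempotent generating the next ideal lies in its
   corner, which the standardly based structure covers. *)
have J_chain i : (i <= n.+1)%N ->
    (J i <= \sum_(y : {k & Lp k} | (tag y < i)%N) Id y)%VS.
  elim: i => [|i IH] iln; first by rewrite [J 0]Jideal0 sub0v.
  have /= JSE := JE (Ordinal iln); rewrite JSE.
  pose o := Ordinal iln; set Z := (\sum_(y | _) _)%VS.
  have JZ : (J i <= Z)%VS.
    apply: subv_trans (IH (ltnW iln)) _; apply/subv_sumP=> y yi.
    by apply: (sumv_sup y) => //; apply: leqW.
  apply: (@subv_trans _ _ (ext_ideal (J o) (I o + \sum_p sb_ideal (S o) p))).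
    apply: subv_trans (addvSr _ _); rewrite prodvSl // prodvSr //.
    apply: subv_trans (sb_cover (hS o)); rewrite -memvE mem_corner ?(ff o) //=.
  rewrite ext_idealD subv_add ext0 JZ /=.
  apply: ext_ideal_sum => // p _.
  exact: (sumv_sup (@existT _ _ o p) (ltnSn i)).
(* Lower levels are larger in the order: strictly above (i,p) lie all levels below i, which
   contribute exactly J_i, and the q strictly above p in level i. *)
have GtE (x : {i & Lp i}) : (\sum_(y | strict (union_le le) x y) Id y)%VS = Gt x.
  case: x => i p; apply/eqP; rewrite eqEsubv; apply/andP; split.
    apply/subv_sumP=> -[j q]; have [ji|ij|/ord_inj e] := ltngtP j i.
    - by move=> _; apply: subv_trans (addvSl _ _); apply: J_sub.
    - rewrite /strict /union_le /= ltnNge (ltnW ij) /= => /andP[/andP[/eqP e]].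
      by rewrite e ltnn in ij.
    - subst j; rewrite strict_union_le_same => pq; apply: ext_idealS.
      by apply: subv_trans (addvSr _ _); apply: (sumv_sup q).
  have JZ : (J i <= \sum_(y | strict (union_le le) (@existT _ _ i p) y) Id y)%VS.
    apply: subv_trans (J_chain i (ltnW (ltn_ord i))) _.
    apply/subv_sumP=> y yi; apply: (sumv_sup y) => //; exact: union_le_low.
  rewrite /Gt /= ext_idealD subv_add ext0 JZ /=; apply: ext_ideal_sum => // q pq.
  by apply: (sumv_sup (@existT _ _ i q)); rewrite ?strict_union_le_same.
(* Levels above i lie below x and drop out, while levels below i stay inside J_i; only level i
   remains. *)
have NleE (x : {i & Lp i}) : (\sum_(y | ~~ union_le le y x) Id y
    <= ext_ideal (J (tag x))
         (sb_nle (I (tag x)) (le (tag x)) (S (tag x)) (tagged x)))%VS.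
  case: x => i p; apply/subv_sumP=> -[j q].
  have [ji|ij|/ord_inj e] := ltngtP j i.
  - by move=> _; apply: subv_trans (addvSl _ _); apply: J_sub.
  - by rewrite /union_le /= ij.
  - subst j; rewrite union_le_same => pq; apply: ext_idealS.
    by apply: subv_trans (addvSr _ _); apply: (sumv_sup q).
have cap x : (Id x :&: \sum_(y | ~~ union_le le y x) Id y <= Gt x)%VS.
  apply: subv_trans (capvS (subvv _) (NleE x)) _.
  exact: (projective_layer_cap (ff _) (Jid _) (JJ' _) (lproj _) (rproj _) (hS _)).
have Gt_sub x : (Gt x <= Id x)%VS.
  apply: ext_idealS; have [_ Sid Smono _ _] := hS (tag x).
  by rewrite subv_add; have [_ ->] := Sid (tagged x); apply/subv_sumP=> q /Smono.
have mono x y : strict (union_le le) x y -> (Id y <= Id x)%VS.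
  move=> xy; apply: subv_trans (Gt_sub x); rewrite -GtE; exact: (sumv_sup y).
exists S0; split=> [|x]; last by have [_ ?] := cP x.
split=> //.
- move=> x; split; last exact: sub0v.
  have Idid : ideal2 (Id x) by apply: ideal2_ext.
  rewrite /ideal_of corner1; split; first exact: subvf.
    by apply/prodvP=> a y _ /(Idid a)[].
  by apply/prodvP=> y a /(Idid a)[].
- apply: sb_complements => // [|x]; last by rewrite GtE.
  (* The top idempotent is 1, so the chain ends at [A] and [J_chain] gives the covering. *)
  have <- : J n.+1 = fullv.
    apply/vspaceP=> z; rewrite memvf (JE ord_max) hfn prodv1.
    by rewrite -[z]mulr1 memv_mul ?memvf.
  apply: subv_trans (J_chain _ (leqnn _)) _; apply/subv_sumP=> y _.
  exact: (sumv_sup y).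
- move=> x; have [[rep_lr map_lin map_surj map_ker map_mul] _] := cP x.
  rewrite /sb_gt add0v /= GtE; split=> // a b y _ _; exact: map_mul.
Qed.
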